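(* Let $\kappa$ be an uncountable regular cardinal and let $R$ be a Noetherian commutative ring whose spectrum $\operatorname{Spec} R$ has cardinality less than $\kappa$. Then every flat $R$-module is a transfinite extension of $<\kappa$-generated flat $R$-modules.
   Context: If $\mathcal C$ is a class of $R$-modules, an $R$-module $M$ is a transfinite extension of modules from $\mathcal C$ if there is a well-ordered chain of submodules $(M_\alpha \mid \alpha \le \sigma)$ with $M_0 = 0$, $M_\sigma = M$, $M_\alpha = \bigcup_{\beta<\alpha} M_\beta$ for every limit ordinal $\alpha \le \sigma$, and $M_{\alpha+1}/M_\alpha$ isomorphic to a module in $\mathcal C$ for every $\alpha<\sigma$. A module is $<\kappa$-generated if it has a generating set of cardinality less than $\kappa$. *)

(* Defs.v *)
From HB Require Import structures.
From mathcomp Require Import all_boot all_order all_algebra.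
From Stdlib Require Import Wellfounded.
Set Implicit Arguments. Unset Strict Implicit. Unset Printing Implicit Defensive.
Import GRing.Theory.
Local Open Scope ring_scope.

Definition card_le (A B : Type) : Prop := exists f : A -> B, injective f.
Definition card_lt (A B : Type) : Prop := card_le A B /\ ~ card_le B A.

(* An uncountable regular cardinal kappa, represented by its initial ordinal:
   a type K with a strict well-order ltK such that every proper initial segment
   has cardinality < |K| (initial ordinal), every unbounded (cofinal) subset has
   cardinality |K| (cf kappa = kappa), and K is not countable. *)
Definition strict_well_order (K : Type) (ltK : K -> K -> Prop) : Prop :=
  (forall x, ~ ltK x x) /\
  (forall x y z, ltK x y -> ltK y z -> ltK x z) /\
  (forall x y, ltK x y \/ x = y \/ ltK y x) /\
  well_founded ltK.

Definition uncountable_regular_cardinal (K : Type) (ltK : K -> K -> Prop) : Prop :=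
  strict_well_order ltK /\
  (forall k : K, card_lt {j : K | ltK j k} K) /\
  (forall S : K -> Prop, (forall k, exists s, S s /\ ~ ltK s k) -> card_le K {s : K | S s}) /\
  ~ card_le K nat.

Definition is_ideal (R : comPzRingType) (I : R -> Prop) : Prop :=
  I 0 /\ (forall x y, I x -> I y -> I (x + y)) /\ (forall r x, I x -> I (r * x)).

Definition is_prime_ideal (R : comPzRingType) (P : R -> Prop) : Prop :=
  is_ideal P /\ ~ P 1 /\ (forall a b, P (a * b) -> P a \/ P b).

Definition Spec (R : comPzRingType) : Type := {P : R -> Prop | is_prime_ideal P}.

Definition noetherian (R : comPzRingType) : Prop :=
  forall I : R -> Prop, is_ideal I ->
    exists s : seq R, (forall x, x \in s -> I x) /\
      (forall y, I y <-> exists c : seq R,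
          size c = size s /\ y = \sum_(i < size s) c`_i * s`_i).

Section Modules.
Variable R : comPzRingType.

Definition is_linear (A B : lmodType R) (f : A -> B) : Prop :=
  forall (r : R) (x y : A), f (r *: x + y) = r *: f x + f y.

Definition is_submodule (M : lmodType R) (S : M -> Prop) : Prop :=
  S 0 /\ (forall x y, S x -> S y -> S (x + y)) /\ (forall (r : R) x, S x -> S (r *: x)).

Definition in_span (M : lmodType R) (X : M -> Prop) (x : M) : Prop :=
  forall S : M -> Prop, is_submodule S -> (forall y, X y -> S y) -> S x.

Definition lt_generated (K : Type) (N : lmodType R) : Prop :=
  exists X : N -> Prop, card_lt {x : N | X x} K /\ forall n : N, in_span X n.

Definition is_bilinear (A M P : lmodType R) (b : A -> M -> P) : Prop :=
  (forall m, is_linear (fun a => b a m)) /\ (forall a, is_linear (b a)).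

Definition is_tensor (A M T : lmodType R) (t : A -> M -> T) : Prop :=
  is_bilinear t /\
  forall (P : lmodType R) (b : A -> M -> P), is_bilinear b ->
    (exists h : T -> P, is_linear h /\ forall a m, h (t a m) = b a m) /\
    (forall h1 h2 : T -> P, is_linear h1 -> is_linear h2 ->
       (forall a m, h1 (t a m) = b a m) -> (forall a m, h2 (t a m) = b a m) ->
       forall z, h1 z = h2 z).

Definition flat (M : lmodType R) : Prop :=
  forall (A B : lmodType R) (f : A -> B), is_linear f -> injective f ->
  forall (TA TB : lmodType R) (tA : A -> M -> TA) (tB : B -> M -> TB),
    is_tensor tA -> is_tensor tB ->
  forall h : TA -> TB, is_linear h -> (forall a m, h (tA a m) = tB (f a) m) ->
    injective h.

Definition quotient_iso (M N : lmodType R) (S S' : M -> Prop) : Prop :=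
  exists g : M -> N,
    (forall (r : R) x y, S' x -> S' y -> g (r *: x + y) = r *: g x + g y) /\
    (forall n : N, exists x, S' x /\ g x = n) /\
    (forall x, S' x -> (g x = 0 <-> S x)).

(* M is a transfinite extension of modules from the class C: a chain
   (M_a | a in I) indexed by a well-ordered set I with a largest element top
   (I is order-isomorphic to sigma+1), with M_bot = 0, M_top = M, continuity at
   limit indices and successive quotients isomorphic to modules in C. *)
Definition transfinite_extension (C : lmodType R -> Prop) (M : lmodType R) : Prop :=
  exists (I : Type) (ltI : I -> I -> Prop) (bot top : I) (Mc : I -> M -> Prop),
    strict_well_order ltI /\
    (forall a, ~ ltI a bot) /\ (forall a, ~ ltI top a) /\
    (forall a, is_submodule (Mc a)) /\
    (forall a b, ltI a b -> forall x, Mc a x -> Mc b x) /\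
    (forall x, Mc bot x <-> x = 0) /\
    (forall x, Mc top x) /\
    (forall a, (exists b, ltI b a) ->
               (forall b, ltI b a -> exists c, ltI b c /\ ltI c a) ->
               forall x, Mc a x <-> exists b, ltI b a /\ Mc b x) /\
    (forall a s, ltI a s -> (forall c, ~ (ltI a c /\ ltI c s)) ->
       exists N : lmodType R, C N /\ quotient_iso N (Mc a) (Mc s)).

End Modules.

(* Main.v *)
(** A module [M] over a noetherian ring is flat as soon as [P (x) M -> M] is
    injective for every prime [P]: an ideal maximal among those for which
    injectivity fails is prime.  If [M] is flat, [N] is a submodule and
    [N ∩ P M = P N] for every prime [P], then [M / N] is therefore flat.

    Submodules of a module with fewer than [kappa] generators again have fewer
    than [kappa] generators, since [R] is noetherian.  As there are fewer than
    [kappa] primes, closing a small set under witnesses for [N ∩ P M = P N] and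
    for the triviality of the relations between generators of [P], [omega]
    times, puts any element of [M] in a [< kappa]-generated flat submodule [N]
    with [M / N] flat.  Iterating this in the successive quotients along a
    well-order of [M] gives the filtration. *)

Require Import Defs.
From HB Require Import structures.
From mathcomp Require Import all_boot all_order all_algebra.
From mathcomp Require Import boolp wochoice.
Set Implicit Arguments. Unset Strict Implicit. Unset Printing Implicit Defensive.
Import GRing.Theory.
Local Open Scope ring_scope.

(** * Small cardinals *)

(** The ring itself may have kappa or more elements, so a small set cannot be closed under solutions
    of all linear systems over [R], the usual way to reach a pure submodule. Fixing one finite
    generating family for each prime leaves fewer than kappa kinds of condition, but each kind still
    ranges over all elements of a span, which may be too many. Linearity saves the count: the
    elements concerned form a submodule, and having a witness in a given submodule is preserved by
    linear combinations, so witnesses for a small generating set suffice. Flatness is defined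
    through arbitrary tensor products given by a universal property. To extract a finite reason for
    the vanishing of a tensor, an explicit tensor product is built from formal sums, in which
    equality is derivability. *)

Lemma card_le_trans (A B C : Type) : card_le A B -> card_le B C -> card_le A C.
Proof.
move=> [f fI] [g gI]; exists (g \o f); exact: inj_comp.
Qed.

Lemma card_le_sig (A : Type) (P : A -> Prop) : card_le {x | P x} A.
Proof. by exists sval => -[x px] [y py] /= xy; apply: eq_exist. Qed.

Lemma surj_card_le (A B : Type) (f : A -> B) :
  (forall b, exists a, f a = b) -> card_le B A.
Proof.
by move=> /choice[g gK]; exists g => x y /(congr1 f); rewrite !gK.
Qed.

Lemma selector (T : Type) : inhabited T ->
  exists sel : (T -> Prop) -> T, forall P, (exists t, P t) -> P (sel P).
Proof.
move=> [t0]; have /choice[sel selP] (P : T -> Prop) : exists t, (exists t, P t) -> P t.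
  by have [[t Pt]|nP] := pselect (exists t, P t); [exists t|exists t0].
by exists sel.
Qed.

Section RegularCardinal.
Variables (K : Type) (ltK : K -> K -> Prop).
Hypothesis hK : uncountable_regular_cardinal ltK.

(** Phrased negatively, as the absence of an injection from [K]: this passes at once to subsets and
    images, and [small_card_lt] turns it into [card_lt]. *)
Definition small (T : Type) : Prop := ~ card_le K T.

Lemma small_le (A B : Type) : card_le A B -> small B -> small A.
Proof. by move=> AB Bs KA; apply/Bs/(card_le_trans KA). Qed.

Lemma small_surj (A B : Type) (f : A -> B) :
  (forall b, exists a, f a = b) -> small A -> small B.
Proof. by move=> /surj_card_le; apply: small_le. Qed.

Lemma small_range (A B : Type) (f : A -> B) :
  small A -> small {b | exists a, f a = b}.
Proof.
pose g a : {b | exists a, f a = b} := exist _ (f a) (ex_intro _ a erefl).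
by apply: (@small_surj _ _ g) => -[b [a ab]]; exists a; apply: eq_exist.
Qed.

Lemma small_nat : small nat.
Proof. by case: hK => _ [_ []]. Qed.

Lemma small_bounded (S : K -> Prop) : small {s | S s} ->
  exists k, forall s, S s -> ltK s k.
Proof.
case: hK => _ [_ [cof _]] Ss; apply: contrapT => nb; apply/Ss/cof => k.
apply: contrapT => nk; apply: nb; exists k => s Ss'.
by apply: contrapT => nsk; apply: nk; exists s.
Qed.

Lemma small_range_bounded (T : Type) (f : T -> K) : small T ->
  exists k, forall t, ltK (f t) k.
Proof.
move=> /(@small_range _ _ f)/small_bounded[k kP].
by exists k => t; apply: kP; exists t.
Qed.

(** Given an injection [e] of [K] into the sum, the indices sent over a fixed [a] form a small set,
    bounded by some [F a]. The bounds [F a] have in turn a common bound [k], and the index [k]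
    itself would lie below [F a], hence below [k], for the [a] over which [e k] lies. *)
Lemma small_sigma (A : Type) (B : A -> Type) :
  small A -> (forall a, small (B a)) -> small {a & B a}.
Proof.
move=> As Bs [e eI].
have bnd a : exists k, forall s, projT1 (e s) = a -> ltK s k.
  apply: small_bounded.
  apply: small_le (Bs a).
  pose h (s : {s | projT1 (e s) = a}) : B a :=
    eq_rect _ B (projT2 (e (sval s))) _ (proj2_sig s).
  exists h => -[s1 p1] [s2 p2]; rewrite /h /= => h12; apply: eq_exist.
  apply: eI; move: h12; case: (e s1) p1 => a1 b1 /= p1; case: (e s2) p2 => a2 b2 /= p2.
  by case: _ / p1 b1 => b1 in p2 *; subst a2 => /= ->.
have [F FP] := choice bnd.
have [k kP] := small_range_bounded F As.
have [[irr [tr _]] _] := hK.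
apply: (irr k); apply: tr (kP (projT1 (e k))).
exact: FP.
Qed.

Lemma small_prod (A B : Type) : small A -> small B -> small (A * B).
Proof.
move=> As Bs; have := small_sigma As (fun=> Bs).
apply: (@small_surj _ _ (fun x : {_ : A & B} => (projT1 x, projT2 x))).
by case=> a b; exists (existT _ a b).
Qed.

Lemma small_sum (A B : Type) : small A -> small B -> small (A + B).
Proof.
move=> As Bs; have b2 : small bool.
  by apply: small_le small_nat; exists nat_of_bool => -[] [].
have := small_sigma (B := fun b : bool => if b then A else B) b2.
move=> /(_ (fun b => if b return small (if b then A else B) then As else Bs)).
pose f (x : {b & if b then A else B}) : A + B :=
  match x with existT true a => inl a | existT false b => inr b end.
apply: (@small_surj _ _ f).
pose P (b : bool) := if b then A else B.
by case=> [a|b]; [exists (existT P true a)|exists (existT P false b)].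
Qed.

Lemma small_seq (A : Type) : small A -> small (seq A).
Proof.
move=> As; have tup n : small {s : seq A | size s = n}.
  elim: n => [|n IH].
    apply: small_le small_nat; exists (fun=> 0%N) => -[s1 p1] [s2 p2] _.
    by apply: eq_exist; rewrite (size0nil p1) (size0nil p2).
  have := small_prod As IH.
  pose f (x : A * {s : seq A | size s = n}) : {s : seq A | size s = n.+1} :=
    exist _ (x.1 :: sval x.2) (congr1 S (svalP x.2)).
  apply: (@small_surj _ _ f) => -[[|a s] p] //; case: (p) => p'.
  by exists (a, exist _ s p'); apply: eq_exist.
have := small_sigma small_nat tup.
pose f (x : {n & {s : seq A | size s = n}}) := sval (projT2 x).
apply: (@small_surj _ _ f) => s.
by exists (existT _ (size s) (exist _ s erefl)).
Qed.

(* Enumerate [T] injectively along [K]: the enumeration must stop before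
   exhausting [K], and then [T] injects into an initial segment. *)
Lemma small_card_lt (T : Type) : small T -> card_lt T K.
Proof.
move=> Ts; split=> //.
have [/selector[sel selP]|nT] := pselect (inhabited T); last first.
  by exists (fun t => False_rect _ (nT (inhabits t))) => t; case: nT.
have [[_ [_ [tot wf]]] _] := hK.
pose step (k : K) (rec : forall j, ltK j k -> T) : T :=
  sel (fun t => forall j (jk : ltK j k), rec j jk <> t).
pose g := Fix wf (fun=> T) step.
have gE k : g k = sel (fun t => forall j, ltK j k -> g j <> t).
  rewrite /g Fix_eq // => x f1 f2 f12; congr (sel _).
  by apply/funext => t; apply/propext; split=> H j jk; [rewrite -f12|rewrite f12].
have [gen|] := pselect (forall k, exists t, forall j, ltK j k -> g j <> t).
  exfalso; apply: Ts; exists g => x y.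
  have gP k j : ltK j k -> g j <> g k.
    by rewrite (gE k) => jk; apply: (selP _ (gen k)).
  by have [/gP|[//|/gP gyx /esym]] := tot x y.
move=> /existsNP[k /forallNP kP].
apply: (card_le_trans (B := {j | ltK j k})); last exact: card_le_sig.
apply: (@surj_card_le _ _ (fun j => g (sval j))) => t.
have /existsNP[j /not_implyP[jk /contrapT gj]] := kP t.
by exists (exist _ j jk).
Qed.

End RegularCardinal.

(** * Quotients, submodules and spans *)

Definition setoid_quotient (X : Type) (E : X -> X -> Prop) : Type :=
  {c : X -> Prop | exists x, c = E x}.
HB.instance Definition _ X E := gen_eqMixin (@setoid_quotient X E).
HB.instance Definition _ X E := gen_choiceMixin (@setoid_quotient X E).

(** Quotients, submodules and tensor products all come from this one construction. The laws are
    required only up to [E], and the opposite is scaling by -1. *)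
Lemma setoid_lmodule (R : comPzRingType) (X : Type) (E : X -> X -> Prop)
    (zero : X) (add : X -> X -> X) (scale : R -> X -> X) :
  (forall x, E x x) -> (forall x y, E x y -> E y x) ->
  (forall x y z, E x y -> E y z -> E x z) ->
  (forall x x' y y', E x x' -> E y y' -> E (add x y) (add x' y')) ->
  (forall r x x', E x x' -> E (scale r x) (scale r x')) ->
  (forall x y z, E (add x (add y z)) (add (add x y) z)) ->
  (forall x y, E (add x y) (add y x)) ->
  (forall x, E (add zero x) x) ->
  (forall x, E (add (scale (-1) x) x) zero) ->
  (forall a b x, E (scale a (scale b x)) (scale (a * b) x)) ->
  (forall x, E (scale 1 x) x) ->
  (forall a x y, E (scale a (add x y)) (add (scale a x) (scale a y))) ->
  (forall a b x, E (scale (a + b) x) (add (scale a x) (scale b x))) ->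
  exists (P : lmodType R) (pi : X -> P),
    (forall p, exists x, pi x = p) /\
    (forall x y, pi x = pi y <-> E x y) /\
    (pi zero = 0) /\
    (forall x y, pi (add x y) = pi x + pi y) /\
    (forall r x, pi (scale r x) = r *: pi x).
Proof.
move=> Er Es Et addE scaleE addA addC add0 addN scaleA scale1 scaleDr scaleDl.
pose Q := setoid_quotient E.
pose pi x : Q := exist _ (E x) (ex_intro _ x erefl).
have piE x y : pi x = pi y <-> E x y.
  split=> [/(congr1 sval) /= Exy|Exy]; first by rewrite Exy.
  apply: eq_exist; apply/funext => z; apply/propext; split; last exact: Et.
  by move=> Exz; apply: Et Exz; apply: Es.
have pis (p : Q) : exists x, pi x = p.
  by case: p => c [x cx]; exists x; apply: eq_exist.
have [rep repK] := choice pis.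
have repE x : E (rep (pi x)) x by apply/piE; rewrite repK.
pose qadd p q := pi (add (rep p) (rep q)).
pose qscale r p := pi (scale r (rep p)).
have piD x y : pi (add x y) = qadd (pi x) (pi y).
  by apply/piE/addE; apply: Es; apply: repE.
have piZ r x : pi (scale r x) = qscale r (pi x).
  by apply/piE/scaleE; apply: Es; apply: repE.
have qaddA : associative qadd.
  move=> p q r; case: (pis p) (pis q) (pis r) => [x <-] [y <-] [z <-].
  by rewrite -!piD; apply/piE.
have qaddC : commutative qadd.
  move=> p q; case: (pis p) (pis q) => [x <-] [y <-].
  by rewrite -!piD; apply/piE.
have qadd0 : left_id (pi zero) qadd.
  by move=> p; have [x <-] := pis p; rewrite -!piD; apply/piE.
have qaddN : left_inverse (pi zero) (qscale (-1)) qadd.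
  by move=> p; have [x <-] := pis p; rewrite -piZ -!piD; apply/piE.
pose ZQ : zmodType := HB.pack Q (GRing.isZmodule.Build Q qaddA qaddC qadd0 qaddN).
have ZpiD x y : (pi x : ZQ) + (pi y : ZQ) = pi (add x y) by rewrite piD.
have qscaleA a b (p : ZQ) : qscale a (qscale b p) = qscale (a * b) p.
  by have [x <-] := pis p; rewrite -!piZ; apply/piE.
have qscale1 : left_id 1 (qscale : R -> ZQ -> ZQ).
  by move=> p; have [x <-] := pis p; rewrite -!piZ; apply/piE.
have qscaleDr : right_distributive (qscale : R -> ZQ -> ZQ) +%R.
  move=> a p q; case: (pis p) (pis q) => [x <-] [y <-].
  by rewrite ZpiD -!piZ ZpiD; apply/piE.
have qscaleDl (p : ZQ) : {morph (qscale^~ p : R -> ZQ) : a b / a + b}.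
  move=> a b; have [x <-] := pis p.
  by rewrite -!piZ ZpiD; apply/piE.
pose LQ : lmodType R := HB.pack ZQ
  (GRing.Zmodule_isLmodule.Build R ZQ qscaleA qscale1 qscaleDr qscaleDl).
by exists LQ, pi.
Qed.

Section LinearAlgebra.
Variable R : comPzRingType.
Implicit Types M N A B : lmodType R.

Section Linear.
Variables (A B : lmodType R) (f : A -> B).
Hypothesis fL : is_linear f.

Lemma is_linearD x y : f (x + y) = f x + f y.
Proof. by have := fL 1 x y; rewrite !scale1r. Qed.

Lemma is_linear0 : f 0 = 0.
Proof. by apply: (addIr (f 0)); rewrite -is_linearD !add0r. Qed.

Lemma is_linearZ r x : f (r *: x) = r *: f x.
Proof. by have := fL r x 0; rewrite is_linear0 !addr0. Qed.

Lemma is_linearB x y : f (x - y) = f x - f y.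
Proof. by rewrite is_linearD -scaleN1r is_linearZ scaleN1r. Qed.

Lemma is_linear_sum (I : Type) (r : seq I) (P : pred I) (F : I -> A) :
  f (\sum_(i <- r | P i) F i) = \sum_(i <- r | P i) f (F i).
Proof. exact: (big_morph f is_linearD is_linear0). Qed.

End Linear.

Section Submodule.
Variables (M : lmodType R) (S : M -> Prop).
Hypothesis hS : is_submodule S.

Lemma submodule0 : S 0. Proof. by case: hS. Qed.
Lemma submoduleD x y : S x -> S y -> S (x + y).
Proof. by case: hS => _ [SD _]; apply: SD. Qed.
Lemma submoduleZ r x : S x -> S (r *: x).
Proof. by case: hS => _ [_ SZ]; apply: SZ. Qed.
Lemma submoduleB x y : S x -> S y -> S (x - y).
Proof. by move=> Sx Sy; apply: submoduleD; rewrite // -scaleN1r; apply: submoduleZ. Qed.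
Lemma submodule_sum (I : Type) (r : seq I) (P : pred I) (F : I -> M) :
  (forall i, P i -> S (F i)) -> S (\sum_(i <- r | P i) F i).
Proof. exact: (big_ind _ submodule0 submoduleD). Qed.

End Submodule.

Lemma submodule_preim A B (f : A -> B) (S : B -> Prop) :
  is_linear f -> is_submodule S -> is_submodule (fun x => S (f x)).
Proof.
move=> fL hS; split; first by rewrite is_linear0 //; apply: submodule0.
split=> [x y Sx Sy|r x Sx]; first by rewrite is_linearD //; apply: submoduleD.
by rewrite is_linearZ //; apply: submoduleZ.
Qed.

Lemma submodule_image A B (f : A -> B) (S : A -> Prop) :
  is_linear f -> is_submodule S -> is_submodule (fun y => exists2 x, S x & f x = y).
Proof.
move=> fL hS; split; first by exists 0; [apply: submodule0|rewrite is_linear0].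
split=> [_ _ [x Sx <-] [y Sy <-]|r _ [x Sx <-]].
  by exists (x + y); [apply: submoduleD|rewrite is_linearD].
by exists (r *: x); [apply: submoduleZ|rewrite is_linearZ].
Qed.

Lemma submodule_cap M (S T : M -> Prop) :
  is_submodule S -> is_submodule T -> is_submodule (fun x => S x /\ T x).
Proof.
move=> hS hT; split; first by split; apply: submodule0.
by split=> [x y [? ?] [? ?]|r x [? ?]]; split; by [apply: submoduleD|apply: submoduleZ].
Qed.

Lemma submodule_ker A B (f : A -> B) : is_linear f -> is_submodule (fun x => f x = 0).
Proof.
move=> fL; split; first exact: is_linear0.
split=> [x y fx fy|r x fx]; first by rewrite is_linearD // fx fy addr0.
by rewrite is_linearZ // fx scaler0.
Qed.

Lemma span_submodule M (X : M -> Prop) : is_submodule (in_span X).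
Proof.
split=> [S hS _|]; first exact: submodule0.
split=> [x y Xx Xy|r x Xx] S hS XS; first by apply: submoduleD => //; [apply: Xx|apply: Xy].
by apply: submoduleZ => //; apply: Xx.
Qed.
Hint Resolve span_submodule : core.

Section Span.
Variables (M : lmodType R) (X : M -> Prop).

Lemma span0 : in_span X 0.
Proof. exact: (submodule0 (span_submodule X)). Qed.
Lemma spanD x y : in_span X x -> in_span X y -> in_span X (x + y).
Proof. exact: (submoduleD (span_submodule X)). Qed.
Lemma spanZ r x : in_span X x -> in_span X (r *: x).
Proof. exact: (submoduleZ (span_submodule X)). Qed.
Lemma spanB x y : in_span X x -> in_span X y -> in_span X (x - y).
Proof. exact: (submoduleB (span_submodule X)). Qed.
Lemma span_sum (I : Type) (r : seq I) (P : pred I) (F : I -> M) :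
  (forall i, P i -> in_span X (F i)) -> in_span X (\sum_(i <- r | P i) F i).
Proof. exact: (submodule_sum (span_submodule X)). Qed.

End Span.

Lemma mem_span M (X : M -> Prop) x : X x -> in_span X x.
Proof. by move=> Xx S _; apply. Qed.

Lemma span_ind M (X P : M -> Prop) : is_submodule P -> (forall x, X x -> P x) ->
  forall x, in_span X x -> P x.
Proof. by move=> hP XP x; apply. Qed.

Lemma span_mono M (X Y : M -> Prop) :
  (forall x, X x -> Y x) -> forall x, in_span X x -> in_span Y x.
Proof. by move=> XY x; apply=> // y /XY; apply: mem_span. Qed.

Lemma span_linear A B (f : A -> B) (X : A -> Prop) (Y : B -> Prop) :
  is_linear f -> (forall x, X x -> in_span Y (f x)) ->
  forall x, in_span X x -> in_span Y (f x).
Proof. by move=> fL XY x /(_ (fun x => in_span Y (f x))); apply=> //; apply: submodule_preim. Qed.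

Lemma span_finite M (X : M -> Prop) x : in_span X x ->
  exists s : seq {x | X x}, in_span (fun y => y \in map sval s) x.
Proof.
move: x; apply: span_ind => [|y Xy]; last first.
  by exists [:: exist _ y Xy]; apply: mem_span; rewrite mem_seq1.
split; first by exists [::]; apply: span0.
split=> [u v [s su] [t tv]|r u [s su]]; last by exists s; apply: spanZ.
exists (s ++ t); apply: spanD => //; [apply: (span_mono _ su)|apply: (span_mono _ tv)] => y;
  by rewrite map_cat mem_cat => ->; rewrite ?orbT.
Qed.

Lemma span_cons M (a : M) (F : seq M) x : in_span (fun y => y \in a :: F) x ->
  exists r, in_span (fun y => y \in F) (x - r *: a).
Proof.
move: x; apply: span_ind => [|y]; last first.
  rewrite inE => /predU1P[->|yF]; first by exists 1; rewrite scale1r subrr; apply: span0.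
  by exists 0; rewrite scale0r subr0; apply: mem_span.
split; first by exists 0; rewrite scale0r subr0; apply: span0.
split=> [u v [r ru] [s sv]|t u [r ru]].
  by exists (r + s); rewrite scalerDl opprD addrACA; apply: spanD.
by exists (t * r); rewrite -scalerA -scalerBr; apply: spanZ.
Qed.

Lemma quotient_lmodule M (S : M -> Prop) : is_submodule S ->
  exists (Q : lmodType R) (pi : M -> Q),
    is_linear pi /\ (forall q, exists x, pi x = q) /\ (forall x, pi x = 0 <-> S x).
Proof.
move=> hS.
have [|||||||||||||Q [pi [pis [piE [pi0 [piD piZ]]]]]] :=
  @setoid_lmodule R M (fun x y => S (x - y)) 0 +%R *:%R.
- by move=> x /=; rewrite subrr; apply: submodule0.
- by move=> x y Sxy /=; rewrite -opprB -scaleN1r; apply: submoduleZ.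
- by move=> x y z Sxy Syz /=; rewrite -(subrKA y); apply: submoduleD.
- by move=> x x' y y' ? ? /=; rewrite opprD addrACA; apply: submoduleD.
- by move=> r x x' ? /=; rewrite -scalerBr; apply: submoduleZ.
- by move=> x y z /=; rewrite addrA subrr; apply: submodule0.
- by move=> x y /=; rewrite (addrC x y) subrr; apply: submodule0.
- by move=> x /=; rewrite add0r subrr; apply: submodule0.
- by move=> x /=; rewrite scaleN1r addNr subrr; apply: submodule0.
- by move=> a b x /=; rewrite scalerA subrr; apply: submodule0.
- by move=> x /=; rewrite scale1r subrr; apply: submodule0.
- by move=> a x y /=; rewrite scalerDr subrr; apply: submodule0.
- by move=> a b x /=; rewrite scalerDl subrr; apply: submodule0.
exists Q, pi; split; first by move=> r x y; rewrite piD piZ.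
by split=> // x; rewrite -pi0 piE subr0.
Qed.

(** The subtype is itself quotiented, by equality of the underlying elements, so that the laws never
    compare membership proofs. *)
Lemma sub_lmodule M (N : M -> Prop) : is_submodule N ->
  exists (P : lmodType R) (i : P -> M),
    is_linear i /\ injective i /\ (forall x, N x <-> exists p, i p = x).
Proof.
move=> hN; pose X := {x | N x}.
pose X0 : X := exist _ 0 (submodule0 hN).
pose Xadd (x y : X) : X := exist _ _ (submoduleD hN (proj2_sig x) (proj2_sig y)).
pose Xscale r (x : X) : X := exist _ _ (submoduleZ hN r (proj2_sig x)).
have [|||||||||||||P [pi [pis [piE [pi0 [piD piZ]]]]]] :=
  @setoid_lmodule R X (fun x y => sval x = sval y) X0 Xadd Xscale.
- by [].
- by move=> x y.
- by move=> x y z /= ->.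
- by move=> x x' y y' /= -> ->.
- by move=> r x x' /= ->.
- by move=> x y z /=; rewrite addrA.
- by move=> x y /=; rewrite addrC.
- by move=> x /=; rewrite add0r.
- by move=> x /=; rewrite scaleN1r addNr.
- by move=> a b x /=; rewrite scalerA.
- by move=> x /=; rewrite scale1r.
- by move=> a x y /=; rewrite scalerDr.
- by move=> a b x /=; rewrite scalerDl.
have [rep repK] := choice pis.
have iE x : sval (rep (pi x)) = sval x by apply/piE; rewrite repK.
exists P, (fun p => sval (rep p)); split; last split.
- move=> r p q; case: (pis p) (pis q) => [x <-] [y <-].
  by rewrite -piZ -piD !iE.
- by move=> p q /piE /=; rewrite !repK.
- move=> x; split=> [Nx|[p <-]]; last exact: proj2_sig.
  by exists (pi (exist _ x Nx)); rewrite iE.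
Qed.

End LinearAlgebra.
#[export] Hint Resolve span_submodule : core.

(** * Tensor products by generators and relations *)

Section Tensor.
Variables (R : comPzRingType) (B Q : lmodType R).
Implicit Types (U : B -> Prop) (l : seq (B * Q)).

(* Formal sums of pure tensors, identified by the relations of the tensor
   product [U (x) Q].  Tensors [a (x) q] with [a] outside [U] remain free in [a]
   (but linear in [q]), so that no membership side condition is needed. *)
Inductive teq U : seq (B * Q) -> seq (B * Q) -> Prop :=
| teq_refl l : teq U l l
| teq_sym l l' : teq U l l' -> teq U l' l
| teq_trans l l' l'' : teq U l l' -> teq U l' l'' -> teq U l l''
| teq_cat l1 l1' l2 l2' : teq U l1 l1' -> teq U l2 l2' -> teq U (l1 ++ l2) (l1' ++ l2')
| teq_comm l1 l2 : teq U (l1 ++ l2) (l2 ++ l1)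
| teq_addl a a' q : U a -> U a' -> teq U [:: (a + a', q)] [:: (a, q); (a', q)]
| teq_addr a q q' : teq U [:: (a, q + q')] [:: (a, q); (a, q')]
| teq_scale r a q : U a -> teq U [:: (r *: a, q)] [:: (a, r *: q)]
| teq_zero a : teq U [:: (a, 0)] [::].

Definition tscale (r : R) l := [seq (x.1, r *: x.2) | x <- l].

Definition tsum (P : lmodType R) (t : B -> Q -> P) l : P := \sum_(x <- l) t x.1 x.2.

Definition bilinear_on U (P : lmodType R) (t : B -> Q -> P) : Prop :=
  (forall a, is_linear (t a)) /\
  (forall a a' q, U a -> U a' -> t (a + a') q = t a q + t a' q) /\
  (forall r a q, U a -> t (r *: a) q = t a (r *: q)).

Lemma tsum_cat (P : lmodType R) (t : B -> Q -> P) l l' :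
  tsum t (l ++ l') = tsum t l + tsum t l'.
Proof. exact: big_cat. Qed.

Lemma tsum_scale (P : lmodType R) (t : B -> Q -> P) r l :
  (forall a, is_linear (t a)) -> tsum t (tscale r l) = r *: tsum t l.
Proof.
move=> tL; rewrite /tsum big_map scaler_sumr; apply: eq_bigr => x _ /=.
exact: is_linearZ.
Qed.

Lemma teq_sound U (P : lmodType R) (t : B -> Q -> P) l l' :
  bilinear_on U t -> teq U l l' -> tsum t l = tsum t l'.
Proof.
move=> [tL [tD tZ]]; elim=> {l l'} //.
- by move=> l l' l'' _ -> _ ->.
- by move=> l1 l1' l2 l2' _ e1 _ e2; rewrite !tsum_cat e1 e2.
- by move=> l1 l2; rewrite !tsum_cat addrC.
- by move=> a a' q Ua Ua'; rewrite /tsum !big_cons !big_nil !addr0 /= tD.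
- by move=> a q q'; rewrite /tsum !big_cons !big_nil !addr0 /= is_linearD.
- by move=> r a q Ua; rewrite /tsum !big_cons !big_nil !addr0 /= tZ.
- by move=> a; rewrite /tsum !big_cons !big_nil !addr0 /= is_linear0.
Qed.

(** A derivation uses additivity and scaling in the first factor at finitely many elements of [U]
    only. This is what lets [flat_of_ideals] replace an arbitrary overmodule by finitely many
    adjoined elements. *)
Lemma teq_compact U l l' : teq U l l' -> exists u : seq B,
  (forall a, a \in u -> U a) /\
  forall U', (forall a, a \in u -> U' a) -> teq U' l l'.
Proof.
have mem2 u1 u2 (P : B -> Prop) : (forall a, a \in u1 ++ u2 -> P a) ->
    (forall a, a \in u1 -> P a) /\ (forall a, a \in u2 -> P a).
  by move=> h; split=> a au; apply: h; rewrite mem_cat au ?orbT.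
have join2 u1 u2 (P : B -> Prop) : (forall a, a \in u1 -> P a) ->
    (forall a, a \in u2 -> P a) -> forall a, a \in u1 ++ u2 -> P a.
  by move=> h1 h2 a; rewrite mem_cat => /orP[/h1|/h2].
elim=> {l l'}.
- by move=> l; exists [::]; split=> // *; apply: teq_refl.
- by move=> l l' _ [u [uU h]]; exists u; split=> // U' uU'; apply/teq_sym/h.
- move=> l l' l'' _ [u [uU h]] _ [u' [uU' h']]; exists (u ++ u'); split; first exact: join2.
  by move=> U' /mem2[/h + /h']; apply: teq_trans.
- move=> l1 l1' l2 l2' _ [u [uU h]] _ [u' [uU' h']]; exists (u ++ u'); split; first exact: join2.
  by move=> U' /mem2[/h + /h']; apply: teq_cat.
- by move=> l1 l2; exists [::]; split=> // *; apply: teq_comm.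
- move=> a a' q Ua Ua'; exists [:: a; a']; split.
    by move=> c; rewrite !inE => /orP[/eqP->|/eqP->].
  by move=> U' h; apply: teq_addl; apply: h; rewrite !inE eqxx ?orbT.
- by move=> a q q'; exists [::]; split=> // *; apply: teq_addr.
- move=> r a q Ua; exists [:: a]; split; first by move=> c; rewrite inE => /eqP->.
  by move=> U' h; apply: teq_scale; apply: h; rewrite inE.
- by move=> a; exists [::]; split=> // *; apply: teq_zero.
Qed.

Lemma teq_shuffle U x y l1 l2 :
  teq U ((x :: l1) ++ (y :: l2)) ([:: x; y] ++ (l1 ++ l2)).
Proof.
apply: (@teq_cat U [:: x] [:: x] (l1 ++ y :: l2) (y :: (l1 ++ l2))).
  exact: teq_refl.
rewrite -cat1s catA -(cat1s y (l1 ++ l2)) catA; apply: teq_cat (teq_refl _ _).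
exact: teq_comm.
Qed.

Lemma teq_cat2 U x y l1 l2 l0 l' : teq U [:: x; y] l0 -> teq U (l1 ++ l2) l' ->
  teq U ((x :: l1) ++ (y :: l2)) (l0 ++ l').
Proof. by move=> h h'; apply: teq_trans (teq_shuffle _ _ _ _ _) (teq_cat h h'). Qed.

Lemma teq_tscale U r l l' : teq U l l' -> teq U (tscale r l) (tscale r l').
Proof.
elim=> {l l'} /=.
- by move=> l; apply: teq_refl.
- by move=> l l' _; apply: teq_sym.
- by move=> l l' l'' _ h _; apply: teq_trans h.
- by move=> l1 l1' l2 l2' _ h _ h'; rewrite /tscale !map_cat; apply: teq_cat.
- by move=> l1 l2; rewrite /tscale !map_cat; apply: teq_comm.
- by move=> a a' q Ua Ua'; apply: teq_addl.
- by move=> a q q'; rewrite scalerDr; apply: teq_addr.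
- by move=> s a q Ua; rewrite scalerA mulrC -scalerA; apply: teq_scale.
- by move=> a; rewrite scaler0; apply: teq_zero.
Qed.

Lemma tensor_model U : exists (T : lmodType R) (t : B -> Q -> T),
  bilinear_on U t /\ (forall l l', tsum t l = tsum t l' <-> teq U l l') /\
  (forall z, exists l, tsum t l = z).
Proof.
have eqT l l' : l = l' -> teq U l l' by move=> ->; apply: teq_refl.
have [|||||||||||||T [pi [pis [piE [pi0 [piD piZ]]]]]] :=
  @setoid_lmodule R (seq (B * Q)) (teq U) [::] cat tscale.
- exact: teq_refl.
- exact: teq_sym.
- exact: teq_trans.
- by move=> x x' y y'; apply: teq_cat.
- exact: teq_tscale.
- by move=> x y z; apply: eqT; rewrite catA.
- exact: teq_comm.
- by move=> x; apply: eqT.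
- elim=> [|[a q] l IH]; first exact: teq_refl.
  apply: (@teq_cat2 U _ _ _ _ [::] [::]) => //.
  apply: teq_trans (teq_zero _ a); rewrite -(addNr q) scaleN1r.
  by apply: teq_sym; apply: teq_addr.
- move=> a b l; apply: eqT; rewrite /tscale -map_comp.
  by apply: eq_map => x /=; rewrite scalerA.
- by move=> l; apply: eqT; rewrite -[RHS]map_id; apply: eq_map => -[a q] /=; rewrite scale1r.
- by move=> a x y; apply: eqT; rewrite /tscale map_cat.
- move=> r s; elim=> [|[a q] l IH]; first exact: teq_refl.
  apply: teq_sym; apply: (@teq_cat2 U _ _ _ _ [:: (a, (r + s) *: q)]); last exact: teq_sym.
  by rewrite scalerDl; apply: teq_sym; apply: teq_addr.
pose t a q := pi [:: (a, q)].
have tE l : tsum t l = pi l.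
  elim: l => [|[a q] l IH]; first by rewrite /tsum big_nil pi0.
  by rewrite -cat1s tsum_cat IH piD /tsum big_seq1.
exists T, t; split; last by split=> [l l'|z]; [rewrite !tE|case: (pis z) => l <-; exists l].
split; last split.
- move=> a r q q'; rewrite /t -piZ -piD; apply/piE; exact: teq_addr.
- by move=> a a' q Ua Ua'; rewrite /t -piD; apply/piE/teq_addl.
- by move=> r a q Ua; apply/piE/teq_scale.
Qed.

Lemma is_bilinear_on (P : lmodType R) (t : B -> Q -> P) :
  is_bilinear t -> bilinear_on (fun=> True) t.
Proof.
move=> [tl tr]; split=> //; split=> [a a' q _ _|r a q _].
  by rewrite (is_linearD (tl q)).
by rewrite (is_linearZ (tl q)) (is_linearZ (tr a)).
Qed.

Lemma tensor_exists : exists (T : lmodType R) (t : B -> Q -> T),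
  is_tensor t /\ (forall l l', tsum t l = tsum t l' <-> teq (fun=> True) l l') /\
  (forall z, exists l, tsum t l = z).
Proof.
have [T [t [[tL [tD tZ]] [tE ts]]]] := tensor_model (fun=> True).
exists T, t; split=> //; split.
  by split=> // q r a a'; rewrite tD // tZ // (is_linearZ (tL a)).
move=> P b bB; have bo := is_bilinear_on bB; split; last first.
  move=> h1 h2 h1L h2L h1b h2b z; have [l <-] := ts z; rewrite /tsum.
  rewrite (is_linear_sum h1L) (is_linear_sum h2L).
  by apply: eq_bigr => x _; rewrite h1b h2b.
have [rep repK] := choice ts.
have hE l : tsum b (rep (tsum t l)) = tsum b l.
  by apply: (teq_sound bo); apply/tE; rewrite repK.
exists (fun z => tsum b (rep z)); split=> [r z z'|a q].
  rewrite -{1}(repK z) -{1}(repK z') -tsum_scale // -tsum_cat hE tsum_cat.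
  by rewrite tsum_scale //; case: bo.
by have := hE [:: (a, q)]; rewrite /tsum !big_seq1.
Qed.

(** The universal properties give maps to the explicit model and back, and uniqueness makes the
    round trip the identity; so generation by pure tensors carries over from the model. *)
Lemma tensor_generated (T : lmodType R) (t : B -> Q -> T) : is_tensor t ->
  forall z, exists l, z = tsum t l.
Proof.
move=> [tB tU] z; have [T0 [t0 [[t0B t0U] [_ t0s]]]] := tensor_exists.
have [[h [hL ht]] _] := tU _ _ t0B; have [[h' [h'L h't]] _] := t0U _ _ tB.
have [_ uniq] := tU _ _ tB.
have [l lz] := t0s (h z); exists l.
transitivity (h' (h z)).
  apply: (uniq id (fun z => h' (h z))) => //.
    by move=> r x y; rewrite hL h'L.
  by move=> a q; rewrite ht h't.
by rewrite -lz /tsum (is_linear_sum h'L); apply: eq_bigr.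
Qed.

Lemma tensor_teq (T : lmodType R) (t : B -> Q -> T) l : is_tensor t ->
  tsum t l = 0 -> teq (fun=> True) l [::].
Proof.
move=> [tB tU] tl; have [T0 [t0 [[t0B t0U] [t0E _]]]] := tensor_exists.
have [[h [hL ht]] _] := tU _ _ t0B.
apply/t0E; transitivity (h (tsum t l)); last by rewrite tl is_linear0 // /tsum big_nil.
by rewrite /tsum (is_linear_sum hL); apply: eq_bigr.
Qed.

End Tensor.

(** * Flatness and prime ideals *)

Section FlatIdeals.
Variables (R : comPzRingType) (Q : lmodType R).

(* [I (x) Q -> Q] is injective. *)
Definition ideal_flat (I : R -> Prop) : Prop :=
  forall l : seq (R^o * Q), (forall x, x \in l -> I x.1) ->
    \sum_(x <- l) (x.1 : R) *: x.2 = 0 -> teq (B := R^o) I l [::].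

Definition adjoin (B : lmodType R) (A : B -> Prop) (b : B) (x : B) : Prop :=
  exists a r, A a /\ x = a + r *: b.

Lemma adjoin_submodule (B : lmodType R) (A : B -> Prop) b :
  is_submodule A -> is_submodule (adjoin A b).
Proof.
move=> hA; split; first by exists 0, 0; rewrite scale0r addr0; split=> //; apply: submodule0.
split=> [_ _ [a [r [Aa ->]]] [a' [r' [Aa' ->]]]|s _ [a [r [Aa ->]]]].
  by exists (a + a'), (r + r'); rewrite scalerDl addrACA; split=> //; apply: submoduleD.
by exists (s *: a), (s * r); rewrite scalerDr scalerA; split=> //; apply: submoduleZ.
Qed.

Lemma sub_adjoin (B : lmodType R) (A : B -> Prop) b x : A x -> adjoin A b x.
Proof. by exists x, 0; rewrite scale0r addr0. Qed.

Lemma mem_adjoin (B : lmodType R) (A : B -> Prop) b : is_submodule A -> adjoin A b b.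
Proof. by exists 0, 1; rewrite scale1r add0r; split=> //; apply: submodule0. Qed.

(* [(A + R b) (x) Q] is the quotient of [A (x) Q + Q] by the relations
   [(- s b (x) q, s q)] with [s] in [(A : b)]. *)
Lemma adjoin_tensor_inj (B : lmodType R) (A : B -> Prop) (b : B) (l : seq (B * Q)) :
  is_submodule A -> ideal_flat (fun r => A (r *: b)) ->
  (forall x, x \in l -> A x.1) -> teq (adjoin A b) l [::] -> teq A l [::].
Proof.
move=> hA fJ lA tl; have [T [t [tB [tE _]]]] := tensor_model Q A.
have [tL [tD tZ]] := tB.
have tN a q : A a -> t (- a) q = - t a q.
  by move=> Aa; rewrite -scaleN1r tZ // (is_linearZ (tL _)) scaleN1r.
pose relsum (m : seq (R^o * Q)) : T * Q :=
  (- \sum_(x <- m) t ((x.1 : R) *: b) x.2, \sum_(x <- m) (x.1 : R) *: x.2).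
pose W z := exists m : seq (R^o * Q), (forall x, x \in m -> A ((x.1 : R) *: b)) /\ z = relsum m.
have hW : is_submodule W.
  split; first by exists [::]; split=> //; rewrite /relsum !big_nil oppr0.
  split=> [_ _ [m [mA ->]] [m' [mA' ->]]|r _ [m [mA ->]]].
    exists (m ++ m'); split; last by rewrite /relsum !big_cat /= opprD.
    by move=> x; rewrite mem_cat => /orP[/mA|/mA'].
  exists (tscale r m); split; first by move=> _ /mapP[x /mA ? ->].
  apply: (congr2 (@pair T Q)); rewrite ?scalerN /tscale big_map scaler_sumr.
    by congr (- _); apply: eq_bigr => x _; rewrite (is_linearZ (tL _)).
  by apply: eq_bigr => x _; rewrite !scalerA mulrC.
have [P [pi [piL [_ piE]]]] := quotient_lmodule hW.
have piw a r a' r' q : A a -> A a' -> a + r *: b = a' + r' *: b ->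
    pi (t a q, r *: q) = pi (t a' q, r' *: q).
  move=> Aa Aa' e; apply/eqP; rewrite -subr_eq0 -(is_linearB piL); apply/eqP/piE.
  have rb : (r - r') *: b = a' - a.
    by apply/eqP; rewrite scalerBl subr_eq addrAC -e addrAC subrr add0r.
  exists [:: (r - r', q)]; split.
    by move=> x; rewrite inE => /eqP-> /=; rewrite rb; apply: submoduleB.
  rewrite /relsum !big_seq1 /= rb scalerBl; apply: (congr2 (@pair T Q)) => //.
  rewrite tD //; last by rewrite -scaleN1r; apply: submoduleZ.
  by rewrite tN // opprD opprK addrC.
(* A decomposition of [c] is not unique, but [piw] makes the choice immaterial. The default [(0, 0)]
   keeps [be c] linear in the second argument for [c] outside [adjoin A b]. *)
have /choice[dec decP] c : exists ar : B * R,
    adjoin A b c -> A ar.1 /\ c = ar.1 + ar.2 *: b.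
  by have [[a [r [Aa cE]]]|nc] := pselect (adjoin A b c); [exists (a, r)|exists (0, 0)].
pose be c q := pi (t (dec c).1 q, (dec c).2 *: q).
have beE a r c q : A a -> c = a + r *: b -> be c q = pi (t a q, r *: q).
  move=> Aa cE; have [|Adc cE'] := decP c; first by exists a, r.
  by apply: piw => //; rewrite -cE' cE.
have bL c : is_linear (be c).
  move=> r q q'; rewrite /be -piL; congr pi; congr (_, _) => /=.
    exact: tL.
  by rewrite scalerDr !scalerA mulrC.
have beB : bilinear_on (adjoin A b) be.
  split=> //; split.
    move=> _ _ q [a [r [Aa ->]]] [a' [r' [Aa' ->]]].
    have e : a + r *: b + (a' + r' *: b) = a + a' + (r + r') *: b.
      by rewrite scalerDl addrACA.
    rewrite (beE _ _ _ _ (submoduleD hA Aa Aa') e) (@beE a r) // (@beE a' r') //.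
    rewrite -(is_linearD piL); congr pi; congr (_, _) => /=; first exact: tD.
    exact: scalerDl.
  move=> s _ q [a [r [Aa ->]]].
  have e : s *: (a + r *: b) = s *: a + (s * r) *: b by rewrite scalerDr scalerA.
  rewrite (beE _ _ _ _ (submoduleZ hA s Aa) e) (@beE a r) //.
  by congr pi; congr (_, _) => /=; [exact: tZ|rewrite scalerA mulrC].
have bel : pi (tsum t l, 0) = 0.
  have := teq_sound beB tl; rewrite {2}/tsum big_nil => <-.
  have -> : (tsum t l, 0) = \sum_(x <- l) (t x.1 x.2, 0 : Q).
    elim: (l) => [|x m IH]; first by rewrite /tsum !big_nil.
    by rewrite big_cons -IH /tsum big_cons; congr (_, _); rewrite addr0.
  rewrite (is_linear_sum piL) /tsum !big_seq; apply: eq_bigr => x /lA Ax.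
  by rewrite (@beE x.1 0) ?scale0r ?addr0.
have /piE[m [mA [tm m0]]] := bel.
apply/tE; rewrite {2}/tsum big_nil tm.
pose tb (s : R^o) q := t ((s : R) *: b) q.
have tbB : bilinear_on (fun s : R^o => A ((s : R) *: b)) tb.
  split=> [s|]; first exact: tL.
  split=> [s s' q As As'|r s q As]; rewrite /tb; first by rewrite scalerDl tD.
  by rewrite -tZ // scalerA.
(* The second component of the relation vanishes, so its tensor over the ideal [(A : b)] is zero by
   [fJ]; multiplying the first factors by [b] shows that the first component vanishes too. *)
have := teq_sound tbB (fJ m mA (esym m0)).
by rewrite /tsum big_nil => ->; rewrite oppr0.
Qed.

Lemma ideal_flat_full (I : R -> Prop) : (forall r, I r) -> ideal_flat I.
Proof.
move=> IT l _ l0; have [T [t [[tL [tD tZ]] [tE _]]]] := tensor_model (B := R^o) Q I.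
apply/tE; rewrite [RHS]/tsum big_nil.
transitivity (t 1 (\sum_(x <- l) (x.1 : R) *: x.2)); last by rewrite l0 is_linear0.
rewrite (is_linear_sum (tL _)); apply: eq_bigr => x _.
by rewrite -tZ //; congr t; rewrite /GRing.scale /= mulr1.
Qed.

(** Otherwise a strictly increasing sequence of members could be chosen; the finitely many
    generators of its union would lie in one term, which would then contain the next. *)
Lemma noetherian_maximal (F : (R -> Prop) -> Prop) : noetherian R ->
  (forall I, F I -> is_ideal I) -> (exists I, F I) ->
  exists I, F I /\ forall J, F J -> (forall x, I x -> J x) -> forall x, J x -> I x.
Proof.
move=> nR FI [I0 FI0]; apply: contrapT => nmax.
have /choice[f fP] (I : {I | F I}) : exists J : {I | F I},
    (forall x, sval I x -> sval J x) /\ exists x, sval J x /\ ~ sval I x.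
  case: I => I FII; apply: contrapT => nJ; apply: nmax; exists I; split=> // J FJ IJ x Jx.
  apply: contrapT => nIx; apply: nJ; exists (exist _ J FJ); split=> //.
  by exists x.
pose c n := sval (iter n f (exist _ I0 FI0)).
have cF n : is_ideal (c n) by apply: FI; rewrite /c; case: (iter _ _ _).
have cS n x : c n x -> c n.+1 x by apply: (fP _).1.
have cm m n x : (m <= n)%N -> c m x -> c n x.
  by move=> /subnK<-; elim: (n - m)%N => // d IH /IH /cS.
have [|s [sU sP]] := nR (fun x => exists n, c n x).
  split; first by exists 0%N; case: (cF 0%N).
  split=> [x y [m xm] [n yn]|r x [n xn]]; last by exists n; case: (cF n) => _ [_]; apply.
  exists (maxn m n); case: (cF (maxn m n)) => _ [cD _].
  by apply: cD; [apply: cm xm; apply: leq_maxl|apply: cm yn; apply: leq_maxr].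
have [N NP] : exists N, forall x, x \in s -> c N x.
  elim: (s) sU => [|y s' IH] sU; first by exists 0%N.
  have [|N NP] := IH; first by move=> x xs; apply: sU; rewrite inE xs orbT.
  have [n yn] : exists n, c n y by apply: sU; rewrite inE eqxx.
  exists (maxn n N) => x; rewrite inE => /predU1P[->|/NP xN].
    by apply: cm yn; apply: leq_maxl.
  by apply: cm xN; apply: leq_maxr.
have [_ [x [xN nxN]]] := fP (iter N f (exist _ I0 FI0)).
have [c0 [cD cZ]] := cF N; apply: nxN.
have /sP[d [_ ->]] : exists n, c n x by exists N.+1.
apply: big_ind => // i _; apply: cZ; apply: NP; exact: mem_nth.
Qed.

(** Let [J] be maximal among the failing ideals, with [a * b] in [J] but neither factor. Then
    [J + R a] and [(J : a)], which contains [b], are both strictly larger than [J], hence do not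
    fail, and [adjoin_tensor_inj] descends from [J + R a] to [J]. *)
Lemma ideal_flat_all : noetherian R ->
  (forall P, is_prime_ideal P -> ideal_flat P) -> forall I, is_ideal I -> ideal_flat I.
Proof.
move=> nR fP I hI; apply: contrapT => nI.
have [||J [[hJ nJ] Jmax]] :=
  @noetherian_maximal (fun I => is_ideal I /\ ~ ideal_flat I) nR.
- by move=> ? [].
- by exists I.
have big J' : is_ideal J' -> (forall x, J x -> J' x) -> (exists x, J' x /\ ~ J x) ->
    ideal_flat J'.
  move=> hJ' JJ' [x [J'x nJx]]; apply: contrapT => nJ'; apply: nJx.
  exact: (Jmax J').
have sJ : is_submodule (J : R^o -> Prop) by [].
apply: nJ; have [J1|nJ1] := pselect (J 1).
  by apply: ideal_flat_full => r; case: hJ => _ [_ JZ]; rewrite -(mulr1 r); apply: JZ.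
have [pJ|npJ] := pselect (is_prime_ideal J); first exact: fP.
have [a [b [Jab nJa nJb]]] : exists a b, [/\ J (a * b), ~ J a & ~ J b].
  apply: contrapT => nab; apply: npJ; split=> //; split=> // a b Jab.
  have [|nJa] := pselect (J a); first by left.
  by right; apply: contrapT => nJb; apply: nab; exists a, b.
move=> l lJ l0; apply: (@adjoin_tensor_inj R^o J (a : R^o)) => //.
  apply: big.
  - apply: (submodule_preim (A := R^o) (f := fun r => (r : R) *: (a : R^o))) sJ.
    by move=> r x y; rewrite scalerDl scalerA.
  - by move=> x Jx; rewrite /GRing.scale /= mulrC; case: hJ => _ [_]; apply.
  - by exists b; split=> //; rewrite /GRing.scale /= mulrC.
apply: big => //.
- exact: (adjoin_submodule (B := R^o) a sJ).
- by move=> x; apply: (sub_adjoin (B := R^o)).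
- by exists a; split=> //; apply: (mem_adjoin (B := R^o)).
- by move=> x /lJ; apply: (sub_adjoin (B := R^o)).
Qed.

(** A tensor killed in [B] is already killed in the image of [f] enlarged by the finitely many
    elements that a derivation mentions. These are removed one at a time by [adjoin_tensor_inj],
    each removal calling on one colon ideal, until the tensor vanishes over the image of [f], a copy
    of [A]. *)
Lemma flat_of_ideals : (forall I, is_ideal I -> ideal_flat I) -> flat Q.
Proof.
move=> fI A B f fL fI' TA TB tA tB hA hB h hL hE.
suff h0 z : h z = 0 -> z = 0.
  move=> x y hxy; apply/eqP; rewrite -subr_eq0; apply/eqP/h0.
  by rewrite is_linearB // hxy subrr.
have [l ->] := tensor_generated hA z; move=> hl.
pose fl := [seq (f x.1, x.2) | x <- l].
have tfl : teq (fun=> True) fl [::].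
  apply: (tensor_teq hB); rewrite -hl /tsum big_map (is_linear_sum hL).
  by apply: eq_bigr => x _; rewrite hE.
pose U b := exists a, f a = b.
have hU : is_submodule U.
  split; first by exists 0; apply: is_linear0.
  split=> [_ _ [a <-] [a' <-]|r _ [a <-]]; first by exists (a + a'); rewrite is_linearD.
  by exists (r *: a); rewrite is_linearZ.
have flU x : x \in fl -> U x.1 by move=> /mapP[y _ ->]; exists y.1.
have [u [_ uP]] := teq_compact tfl.
pose Uu (v : seq B) := foldr (fun b V => adjoin V b) U v.
have hUu v : is_submodule (Uu v) by elim: v => //= b v; apply: adjoin_submodule.
have UUu v b : U b -> Uu v b by elim: v => //= c v IH /IH; apply: sub_adjoin.
have tU : teq (Uu u) fl [::].
  apply: uP => a; elim: u => //= b v IH; rewrite inE => /predU1P[->|/IH].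
    exact: mem_adjoin.
  exact: sub_adjoin.
have {uP tU} tU : teq U fl [::].
  elim: (u) tU => //= b v IH tU; apply: IH; apply: (adjoin_tensor_inj _ _ _ tU) => //.
    apply: fI; apply: (submodule_preim (A := R^o) (f := fun r => (r : R) *: b)) (hUu v).
    by move=> r x y; rewrite scalerDl scalerA.
  by move=> x /flU; apply: UUu.
have [[tAl tAr] _] := hA.
have /choice[g gP] b : exists a, U b -> f a = b.
  by have [[a ab]|nb] := pselect (U b); [exists a|exists 0].
have gf a : g (f a) = a by apply: fI'; apply: gP; exists a.
pose be b q := tA (g b) q.
have beB : bilinear_on U be.
  split=> [b|]; first exact: tAr.
  split=> [_ _ q [a <-] [a' <-]|r _ q [a <-]]; rewrite /be.
    by rewrite -(is_linearD fL) !gf (is_linearD (tAl q)).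
  by rewrite -(is_linearZ fL) !gf (is_linearZ (tAr _)) (is_linearZ (tAl q)).
transitivity (tsum be fl); last by rewrite (teq_sound beB tU) /tsum big_nil.
by rewrite /tsum big_map; apply: eq_bigr => x _; rewrite /be /= gf.
Qed.

End FlatIdeals.

(** * Flatness and relations between generators of an ideal *)

Section Syzygies.
Variables (R : comPzRingType) (k : nat) (g : 'I_k -> R).

Definition lincomb (Q : lmodType R) (n : {ffun 'I_k -> Q}) : Q := \sum_i g i *: n i.

Definition vscale (Q : lmodType R) (c : {ffun 'I_k -> R^o}) (y : Q) : {ffun 'I_k -> Q} :=
  [ffun i => (c i : R) *: y].

(** Identifying [k]-tuples in [Q] with the tensor product of [R^k] and [Q], these are the pure
    tensors of a syzygy of [g] with an element of [N]. *)
Definition trivial_relation (Q : lmodType R) (N : Q -> Prop) (v : {ffun 'I_k -> Q}) : Prop :=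
  exists c y, lincomb (Q := R^o) c = 0 /\ N y /\ v = vscale c y.

(** For [S] equal to [N], a submodule, this is the equational form of injectivity of the map from
    the tensor product of the ideal of [g] with [N] to [N]. The two sets are kept apart so that
    relations at one stage of a closure can become trivial at the next. *)
Definition relatively_flat (Q : lmodType R) (S N : Q -> Prop) : Prop :=
  forall n : {ffun 'I_k -> Q}, (forall i, S (n i)) -> lincomb n = 0 ->
    in_span (trivial_relation N) n.

Definition syzygy_flat (Q : lmodType R) (N : Q -> Prop) : Prop := relatively_flat N N.

Definition generates (I : R -> Prop) : Prop :=
  forall x, I x <-> exists c : {ffun 'I_k -> R^o}, x = lincomb (Q := R^o) c.

Lemma lincomb_linear (Q : lmodType R) : is_linear (@lincomb Q).
Proof.
move=> r x y; rewrite /lincomb scaler_sumr -big_split; apply: eq_bigr => i _ /=.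
by rewrite !ffunE scalerDr !scalerA mulrC.
Qed.

Lemma vscale_linear (Q : lmodType R) c : is_linear (@vscale Q c).
Proof.
by move=> r x y; apply/ffunP => i; rewrite !ffunE scalerDr !scalerA mulrC.
Qed.

Lemma vscale_linearl (Q : lmodType R) (y : Q) : is_linear (fun c => vscale c y).
Proof.
by move=> r c d; apply/ffunP => i; rewrite !ffunE scalerDl scalerA.
Qed.

Lemma lincomb_vscale (Q : lmodType R) c (y : Q) :
  lincomb (vscale c y) = (lincomb (Q := R^o) c : R) *: y.
Proof. by rewrite scaler_suml; apply: eq_bigr => i _; rewrite ffunE scalerA. Qed.

Definition vunit (i : 'I_k) : {ffun 'I_k -> R^o} := [ffun j => (i == j)%:R].

Lemma lincomb_unit i : lincomb (Q := R^o) (vunit i) = g i.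
Proof.
rewrite /lincomb (bigD1 i) //= ffunE eqxx big1 => [|j ji].
  by rewrite addr0 /GRing.scale /= mulr1.
by rewrite ffunE eq_sym (negPf ji) scaler0.
Qed.

Lemma vunit_sum (Q : lmodType R) (n : {ffun 'I_k -> Q}) :
  n = \sum_i vscale (vunit i) (n i).
Proof.
apply/ffunP => j; rewrite sum_ffunE (bigD1 j) //= !ffunE eqxx scale1r big1 ?addr0 // => i ij.
by rewrite !ffunE (negPf ij) scale0r.
Qed.

(** Every tensor over [I] can be written as the sum of the [g i] tensored with some [n i], and its
    image in [Q] is [lincomb n]. A trivial relation given by [c] and [y] yields the tensor of
    [lincomb c], which is 0, with [y]. *)
Lemma syzygy_ideal_flat (Q : lmodType R) (I : R -> Prop) :
  is_ideal I -> generates I -> syzygy_flat (fun _ : Q => True) -> ideal_flat Q I.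
Proof.
move=> hI gI sf l lI l0; have [T [t [[tL [tD tZ]] [tE _]]]] := tensor_model (B := R^o) Q I.
have sI : is_submodule (I : R^o -> Prop) by [].
have Ig i : I (g i) by apply/gI; exists (vunit i); rewrite lincomb_unit.
have t0 q : t 0 q = 0.
  by rewrite -(scale0r 0) tZ ?scale0r; [exact: is_linear0|exact: (submodule0 sI)].
have tlin (c : {ffun 'I_k -> R^o}) q :
    t (lincomb (Q := R^o) c) q = \sum_i t (g i) ((c i : R) *: q).
  rewrite /lincomb; pose P (a : R^o) z := I a /\ t a q = z.
  suff : P (\sum_i g i *: c i) (\sum_i t (g i) ((c i : R) *: q)) by case.
  apply: (big_ind2 P); first by split; [exact: (submodule0 sI)|].
    by move=> a z a' z' [Ia <-] [Ia' <-]; split; [exact: (submoduleD sI)|rewrite tD].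
  move=> i _; have -> : g i *: c i = (c i : R) *: (g i : R^o) :> R^o.
    by rewrite /GRing.scale /= mulrC.
  by split; [exact: (submoduleZ sI)|rewrite tZ].
pose phi (n : {ffun 'I_k -> Q}) := \sum_i t (g i) (n i).
have phiL : is_linear phi.
  move=> r x y; rewrite /phi scaler_sumr -big_split; apply: eq_bigr => i _ /=.
  by rewrite !ffunE tL.
have [n [nl nt]] : exists n : {ffun 'I_k -> Q},
    \sum_(x <- l) (x.1 : R) *: x.2 = lincomb n /\ tsum t l = phi n.
  elim: (l) lI => [|x m IH] mI.
    exists 0; rewrite /tsum !big_nil; split; last by rewrite is_linear0.
    by rewrite (is_linear0 (@lincomb_linear Q)).
  have [|n [e1 e2]] := IH; first by move=> y ym; apply: mI; rewrite inE ym orbT.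
  have /gI[c xc] : I x.1 by apply: mI; rewrite inE eqxx.
  exists (vscale c x.2 + n); rewrite (is_linearD (@lincomb_linear Q)) (is_linearD phiL).
  rewrite /tsum !big_cons -e1 -/(tsum t m) -e2 lincomb_vscale xc; split=> //.
  by rewrite tlin; congr (_ + _); apply: eq_bigr => i _; rewrite ffunE.
apply/tE; rewrite nt [RHS]/tsum big_nil.
apply: (sf n _ _ (fun n => phi n = 0)) => //; first by rewrite -nl.
  exact: submodule_ker.
move=> _ [c [y [c0 [_ ->]]]]; transitivity (t (lincomb (Q := R^o) c) y); last by rewrite c0 t0.
by rewrite tlin; apply: eq_bigr => i _; rewrite ffunE.
Qed.

Lemma scale_tensor (M : lmodType R) : is_tensor (fun (r : R^o) (m : M) => (r : R) *: m).
Proof.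
split.
  split=> [m r x y|a r x y]; first by rewrite scalerDl scalerA.
  by rewrite scalerDr !scalerA mulrC.
move=> P b [bl br]; split.
  exists (b 1); split=> // a m; rewrite (is_linearZ (br _)) -(is_linearZ (bl m)).
  by congr b; rewrite /GRing.scale /= mulr1.
by move=> h1 h2 _ _ e1 e2 z; rewrite -(scale1r z) e1 e2.
Qed.

(* Apply flatness to the injection [R^k / ker g -> R], and detect a tensor of
   [(R^k / ker g) (x) M] in the quotient of [M^k] by the trivial relations. *)
Lemma flat_syzygy (M : lmodType R) : flat M -> syzygy_flat (fun _ : M => True).
Proof.
move=> fM n _ n0.
have lL := @lincomb_linear R^o.
have [A [p [pL [ps pE]]]] := quotient_lmodule (submodule_ker lL).
have [P [pi [piL [_ piE]]]] :=
  quotient_lmodule (span_submodule (trivial_relation (fun _ : M => True))).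
have [rep repK] := choice ps.
have repE x : lincomb (Q := R^o) (rep (p x) - x) = 0.
  by apply/pE; rewrite (is_linearB pL) repK subrr.
pose f a := lincomb (Q := R^o) (rep a).
have fp x : f (p x) = lincomb (Q := R^o) x.
  by apply/eqP; rewrite -subr_eq0 /f -(is_linearB lL) repE.
have fL : is_linear f.
  move=> r a a'; case: (ps a) (ps a') => [x <-] [y <-].
  by rewrite -pL !fp lL.
have fI : injective f.
  move=> a a'; case: (ps a) (ps a') => [x <-] [y <-]; rewrite !fp => xy.
  apply/eqP; rewrite -subr_eq0 -(is_linearB pL); apply/eqP/pE.
  by rewrite (is_linearB lL) xy subrr.
pose b a (m : M) := pi (vscale (rep a) m).
(* Two representatives of a class differ by a syzygy of [g], so their products with [m] differ by a
   trivial relation, which [pi] kills. *)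
have bp x m : b (p x) m = pi (vscale x m).
  apply/eqP; rewrite -subr_eq0 -(is_linearB piL) -(is_linearB (vscale_linearl m)).
  by apply/eqP/piE; apply: mem_span; exists (rep (p x) - x), m.
have bB : is_bilinear b.
  split=> [m r a a'|a r m m']; last by rewrite /b vscale_linear piL.
  case: (ps a) (ps a') => [x <-] [y <-].
  by rewrite -pL !bp (vscale_linearl m) piL.
have [T [t [[tB tU] _]]] := tensor_exists A M.
have fB : is_bilinear (fun a (m : M) => (f a : R) *: m).
  split=> [m r a a'|a r m m']; first by rewrite fL scalerDl scalerA.
  by rewrite scalerDr !scalerA mulrC.
have [[h [hL hE]] _] := tU _ _ fB.
have [[h' [h'L h'E]] _] := tU _ _ bB.
have hI := fM _ _ _ fL fI _ _ _ _ (conj tB tU) (scale_tensor M) h hL hE.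
apply/piE; rewrite [n in LHS]vunit_sum (is_linear_sum piL).
have z0 : \sum_i t (p (vunit i)) (n i) = 0.
  apply: hI; rewrite (is_linear_sum hL) (is_linear0 hL).
  rewrite -[RHS]n0; apply: eq_bigr => i _.
  by rewrite hE fp lincomb_unit.
transitivity (h' (\sum_i t (p (vunit i)) (n i))); last by rewrite z0 is_linear0.
by rewrite (is_linear_sum h'L); apply: eq_bigr => i _; rewrite h'E bp.
Qed.

End Syzygies.

(** * Small pure hulls *)

Section Noetherian.
Variable R : comPzRingType.
Hypothesis nR : noetherian R.

Lemma ideal_generators (I : R -> Prop) : is_ideal I ->
  exists kg : {k : nat & 'I_k -> R}, generates (projT2 kg) I.
Proof.
move=> /nR[s [_ sP]]; exists (existT (fun k => 'I_k -> R) (size s) (fun i : 'I_(size s) => s`_i)) => x /=.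
rewrite sP; split=> [[c [_ ->]]|[c ->]].
  exists [ffun i : 'I_(size s) => c`_i]; apply: eq_bigr => i _.
  by rewrite ffunE /GRing.scale /= mulrC.
exists [seq c i | i <- enum 'I_(size s)]; split; first by rewrite size_map size_enum_ord.
apply: eq_bigr => i _.
by rewrite (nth_map i) ?size_enum_ord // nth_ord_enum /GRing.scale /= mulrC.
Qed.

(** Induction on the generators: the coefficients of [a] that occur in elements of [W] modulo the
    span of [F] form an ideal. Lifts of its finitely many generators, together with generators of
    the part of [W] inside the span of [F], generate [W]. *)
Lemma noetherian_submodule (X : lmodType R) (F : seq X) (W : X -> Prop) :
  is_submodule W -> (forall w, W w -> in_span (fun x => x \in F) w) ->
  exists s : seq X, (forall x, x \in s -> W x) /\
    forall w, W w -> in_span (fun x => x \in s) w.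
Proof.
elim: F W => [|a F IH] W hW WF; first by exists [::]; split.
pose W' w := W w /\ in_span (fun x => x \in F) w.
have [||s' [s'W s'P]] := IH W'.
- exact: submodule_cap.
- by move=> w [].
pose I r := exists w, W w /\ in_span (fun x => x \in F) (w - r *: a).
have hI : is_ideal I.
  split; first by exists 0; rewrite scale0r subr0; split; [exact: submodule0|exact: span0].
  split=> [r r' [w [Ww wF]] [w' [Ww' wF']]|t r [w [Ww wF]]].
    exists (w + w'); split; first exact: submoduleD.
    by rewrite scalerDl opprD addrACA; apply: spanD.
  exists (t *: w); split; first exact: submoduleZ.
  by rewrite -scalerA -scalerBr; apply: spanZ.
have [[k g] /= gI] := ideal_generators hI.
have /choice[wit witP] i : exists w, W w /\ in_span (fun x => x \in F) (w - g i *: a).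
  by apply/gI; exists (vunit R i); rewrite lincomb_unit.
exists ([seq wit i | i <- enum 'I_k] ++ s'); split.
  by move=> x; rewrite mem_cat => /orP[/mapP[i _ ->]|/s'W[]//]; case: (witP i).
move=> w Ww; have [r wr] := span_cons (WF w Ww).
have /gI[c rc] : I r by exists w.
rewrite -(subrK (\sum_i (c i : R) *: wit i) w); apply: spanD.
  apply: (@span_mono _ _ (fun x => x \in s')); first by move=> x xs; rewrite mem_cat xs orbT.
  apply: s'P; split.
    apply: submoduleB => //; apply: submodule_sum => // i _.
    by apply: submoduleZ => //; case: (witP i).
  have -> : w - \sum_i (c i : R) *: wit i
          = w - r *: a - \sum_i (c i : R) *: (wit i - g i *: a).
    rewrite -addrA -opprD; congr (_ - _).
    under [in RHS]eq_bigr => i _ do rewrite scalerBr scalerA.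
    rewrite sumrB rc /lincomb scaler_suml.
    under [in RHS]eq_bigr => i _ do rewrite /GRing.scale /= mulrC.
    by rewrite addrC subrK.
  by apply: spanB => //; apply: span_sum => i _; apply: spanZ; case: (witP i).
apply: span_sum => i _; apply: spanZ; apply: mem_span.
by rewrite mem_cat; apply/orP; left; apply: map_f; rewrite mem_enum.
Qed.

(** * Closing small sets under witnesses for purity and flatness *)

Section Small.
Variables (K : Type) (ltK : K -> K -> Prop).
Hypothesis hK : uncountable_regular_cardinal ltK.
Let small := small K.

Definition small_set (T : Type) (X : T -> Prop) : Prop := small {x | X x}.

Lemma small_set_range (A T : Type) (f : A -> T) :
  small A -> small_set (fun x => exists a, f a = x).
Proof. exact: small_range. Qed.

Lemma small_set_bigcup (A T : Type) (X : A -> T -> Prop) :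
  small A -> (forall a, small_set (X a)) -> small_set (fun x => exists a, X a x).
Proof.
move=> As Xs; have := small_sigma hK As Xs.
pose f (y : {a & {x | X a x}}) : {x | exists a, X a x} :=
  exist _ (sval (projT2 y)) (ex_intro _ (projT1 y) (proj2_sig (projT2 y))).
apply: (@small_surj _ _ _ f) => -[x [a xa]].
by exists (existT _ a (exist _ x xa)); apply: eq_exist.
Qed.

Lemma small_setU (T : Type) (X Y : T -> Prop) :
  small_set X -> small_set Y -> small_set (fun x => X x \/ Y x).
Proof.
move=> Xs Ys; have := small_sum hK Xs Ys.
pose f (y : {x | X x} + {x | Y x}) : {x | X x \/ Y x} :=
  match y with
  | inl z => exist _ (sval z) (or_introl (proj2_sig z))
  | inr z => exist _ (sval z) (or_intror (proj2_sig z))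
  end.
apply: (@small_surj _ _ _ f) => -[x [Xx|Yx]].
  by exists (inl (exist _ x Xx)); apply: eq_exist.
by exists (inr (exist _ x Yx)); apply: eq_exist.
Qed.

(* A submodule of a small-generated module is the union of its intersections
   with the finitely generated submodules. *)
Lemma small_submodule (X : lmodType R) (S W : X -> Prop) :
  small_set S -> is_submodule W -> (forall w, W w -> in_span S w) ->
  exists Y, small_set Y /\ (forall y, Y y -> W y) /\ forall w, W w -> in_span Y w.
Proof.
move=> Ss hW WS.
have /choice[gens gensP] (F : seq {x | S x}) : exists s : seq X,
    (forall x, x \in s -> W x) /\ forall w, W w ->
    in_span (fun x => x \in map sval F) w -> in_span (fun x => x \in s) w.
  have [||s [sW sP]] := @noetherian_submodule X (map sval F)
    (fun w => W w /\ in_span (fun x => x \in map sval F) w).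
  - exact: submodule_cap.
  - by move=> w [].
  exists s; split=> [x /sW[]//|w Ww wF]; exact: sP.
pose nthgen (Fj : seq {x | S x} * nat) := nth 0 (gens Fj.1) Fj.2.
exists (fun x => exists Fj, nthgen Fj = x); split; last split.
- exact/small_set_range/(small_prod hK (small_seq hK Ss))/(small_nat hK).
- move=> _ [[F j] <-]; rewrite /nthgen /=; have [jF|Fj] := ltnP j (size (gens F)).
    by apply: (gensP F).1; apply: mem_nth.
  by rewrite nth_default //; apply: submodule0.
- move=> w Ww; have [F wF] := span_finite (WS w Ww).
  apply: span_mono ((gensP F).2 w Ww wF) => x /(nthP 0)[j _ <-].
  by exists (F, j).
Qed.

(* It suffices to treat a small set of generators of [W]. *)
Lemma small_witnesses (X Q : lmodType R) (S W : X -> Prop) (Phi : (Q -> Prop) -> X -> Prop) :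
  small_set S -> is_submodule W -> (forall w, W w -> in_span S w) ->
  (forall N, is_submodule N -> is_submodule (Phi N)) ->
  (forall w, W w -> exists s : seq Q, forall N, is_submodule N ->
     (forall y, y \in s -> N y) -> Phi N w) ->
  exists Z : Q -> Prop, small_set Z /\ forall N, is_submodule N ->
    (forall z, Z z -> N z) -> forall w, W w -> Phi N w.
Proof.
move=> Ss hW WS hPhi finPhi; have [Y [Ys [YW YP]]] := small_submodule Ss hW WS.
have /choice[fin finP] w : exists s : seq Q, W w -> forall N, is_submodule N ->
    (forall y, y \in s -> N y) -> Phi N w.
  by have [/finPhi[s sP]|nW] := pselect (W w); [exists s|exists [::]].
pose nthfin (yj : {x | Y x} * nat) := nth 0 (fin (sval yj.1)) yj.2.
exists (fun x => exists yj, nthfin yj = x); split.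
  exact/small_set_range/(small_prod hK Ys)/(small_nat hK).
move=> N hN ZN w Ww; apply: (YP w Ww (Phi N)); first exact: hPhi.
move=> y Yy; apply: finP => //; first exact: YW.
move=> z /(nthP 0)[j _ <-]; apply: ZN; by exists (exist _ y Yy, j).
Qed.

(** With [I] the ideal generated by [g] and [N] a submodule, this says that the intersection of [S]
    and [I Q] lies in [I N]. *)
Definition relatively_pure k (g : 'I_k -> R) (Q : lmodType R) (S N : Q -> Prop) : Prop :=
  forall m : {ffun 'I_k -> Q}, S (lincomb g m) ->
    exists n : {ffun 'I_k -> Q}, (forall i, N (n i)) /\ lincomb g n = lincomb g m.

(** The elements to be treated form the submodule of [in_span S] cut out by [I Q], and the [k]
    coefficients of one expression witness each of them. *)
Lemma pure_witnesses k (g : 'I_k -> R) (Q : lmodType R) (S : Q -> Prop) : small_set S ->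
  exists Z : Q -> Prop, small_set Z /\ forall N, is_submodule N ->
    (forall z, Z z -> N z) -> relatively_pure g (in_span S) N.
Proof.
move=> Ss; have lL := @lincomb_linear R k g Q.
have lS (N : Q -> Prop) : is_submodule N ->
    is_submodule (fun w => exists2 n : {ffun 'I_k -> Q}, forall i, N (n i) & lincomb g n = w).
  move=> hN; apply: submodule_image => //.
  split; first by move=> i; rewrite ffunE; apply: submodule0.
  by split=> [x y Nx Ny i|r x Nx i]; rewrite ffunE; [apply: submoduleD|apply: submoduleZ].
have hT : is_submodule (fun _ : Q => True) by [].
pose W w := in_span S w /\ exists2 n : {ffun 'I_k -> Q}, forall i : 'I_k, True & lincomb g n = w.
have [||//||Z [Zs ZP]] := @small_witnesses Q Q S W (fun N w =>
  exists2 n : {ffun 'I_k -> Q}, forall i, N (n i) & lincomb g n = w) Ss.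
- apply: submodule_cap => //; exact: (lS _ hT).
- by move=> w [].
- move=> w [_ [n _ nw]]; exists [seq n i | i <- enum 'I_k] => N _ nN; exists n => // i.
  by apply: nN; apply: map_f; rewrite mem_enum.
exists Z; split=> // N hN ZN m Sm.
have [|n nN nm] := ZP N hN ZN (lincomb g m); first by split=> //; exists m.
by exists n.
Qed.

(** The relations with entries in [in_span S] form a submodule of a small-generated module of
    tuples; the witnesses of one are the finitely many [y] in an expression by trivial relations. *)
Lemma flat_witnesses k (g : 'I_k -> R) (Q : lmodType R) (S : Q -> Prop) : small_set S ->
  syzygy_flat g (fun _ : Q => True) ->
  exists Z : Q -> Prop, small_set Z /\ forall N, is_submodule N ->
    (forall z, Z z -> N z) -> relatively_flat g (in_span S) N.
Proof.
move=> Ss sf; have lL := @lincomb_linear R k g Q.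
(* Elements of [S] placed in a single coordinate generate the tuples over [in_span S]. *)
pose S2 v := exists iy : 'I_k * {x | S x}, vscale (vunit R iy.1) (sval iy.2) = v.
have S2s : small_set S2.
  apply/small_set_range/(small_prod hK) => //.
  apply: (@small_le K _ nat); last exact: small_nat hK.
  by exists (@nat_of_ord k); apply: ord_inj.
pose W (n : {ffun 'I_k -> Q}) := (forall i, in_span S (n i)) /\ lincomb g n = 0.
have [||||Z [Zs ZP]] := @small_witnesses _ Q S2 W (fun N => in_span (trivial_relation g N)) S2s.
- apply: submodule_cap; last exact: submodule_ker.
  split; first by move=> i; rewrite ffunE; apply: span0.
  by split=> [x y Nx Ny i|r x Nx i]; rewrite ffunE; [apply: spanD|apply: spanZ].
- move=> n [nS _]; rewrite (vunit_sum n); apply: span_sum => i _.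
  apply: (@span_linear _ _ _ (vscale (vunit R i)) S) (nS i); first exact: vscale_linear.
  by move=> x Sx; apply: mem_span; exists (i, exist _ x Sx).
- by move=> N _.
- move=> n [_ /(sf n (fun=> I))]; move: n; apply: span_ind.
    split; first by exists [::] => N _ _; apply: span0.
    split=> [x y [s sP] [s' sP']|r x [s sP]].
      exists (s ++ s') => N hN sN; apply: spanD; [apply: sP|apply: sP'] => // z zs;
        by apply: sN; rewrite mem_cat zs ?orbT.
    by exists s => N hN sN; apply: spanZ; apply: sP.
  move=> _ [c [y [c0 [_ ->]]]]; exists [:: y] => N _ yN; apply: mem_span.
  by exists c, y; split=> //; split=> //; apply: yN; rewrite inE.
by exists Z; split=> // N hN ZN n nS n0; apply: (ZP N hN ZN n).
Qed.

Section Hull.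
Hypothesis sSpec : small (Spec R).
Variable gens : Spec R -> {k : nat & 'I_k -> R}.
Local Notation gen P := (projT2 (gens P)).

Variable Q : lmodType R.
Hypothesis fQ : forall P, syzygy_flat (gen P) (fun _ : Q => True).

(** The conclusion holds for every submodule containing the next stage, hence also for the span of
    the union of all stages. *)
Lemma hull_step (S : {S : Q -> Prop | small_set S}) : exists S' : {S : Q -> Prop | small_set S},
  (forall x, sval S x -> sval S' x) /\
  forall P N, is_submodule N -> (forall x, sval S' x -> N x) ->
    relatively_pure (gen P) (in_span (sval S)) N /\
    relatively_flat (gen P) (in_span (sval S)) N.
Proof.
case: S => S Ss /=.
have /choice[Z1 Z1P] P := pure_witnesses (gen P) Ss.
have /choice[Z2 Z2P] P := flat_witnesses Ss (@fQ P).
have S's : small_set (fun x => S x \/ exists P, Z1 P x \/ Z2 P x).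
  apply: small_setU => //; apply: small_set_bigcup => // P.
  by apply: small_setU; [case: (Z1P P)|case: (Z2P P)].
exists (exist _ _ S's) => /=; split=> [x|P N hN SN]; first by left.
split; [apply: (Z1P P).2|apply: (Z2P P).2] => // z Zz; apply: SN; right; exists P; by [left|right].
Qed.

(** Each condition on the span of the union involves finitely many elements, so it already lives at
    a finite stage and is met by the witnesses of the following one. Countable unions stay small
    because [K] is regular and uncountable. *)
Lemma pure_flat_hull (b : Q) : exists X : Q -> Prop, small_set X /\ X b /\
  forall P, relatively_pure (gen P) (in_span X) (in_span X) /\
            syzygy_flat (gen P) (in_span X).
Proof.
have /choice[f fP] := hull_step.
have bs : small_set (fun x => x = b).
  apply: small_le (small_nat hK); exists (fun=> 0%N) => -[x xb] [y yb] _.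
  by apply: eq_exist; rewrite xb yb.
pose c n := sval (iter n f (exist _ _ bs)).
pose X x := exists n, c n x.
have cs n : small_set (c n) by rewrite /c; case: (iter _ _ _).
have cm m n x : (m <= n)%N -> c m x -> c n x.
  by move=> /subnK<-; elim: (n - m)%N => // d IH /IH; apply: (fP _).1.
have csm m n x : (m <= n)%N -> in_span (c m) x -> in_span (c n) x.
  by move=> mn; apply: span_mono => y; apply: cm.
have Xc x : in_span X x -> exists n, in_span (c n) x.
  move: x; apply: span_ind => [|x [n xn]]; last by exists n; apply: mem_span.
  split; first by exists 0%N; apply: span0.
  split=> [x y [m xm] [n yn]|r x [n xn]]; last by exists n; apply: spanZ.
  exists (maxn m n); apply: spanD; [apply: csm xm|apply: csm yn];
    by rewrite ?leq_maxl ?leq_maxr.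
have cX n x : c n x -> in_span X x by move=> xn; apply: mem_span; exists n.
exists X; split; first exact: (small_set_bigcup (small_nat hK)).
split; first by exists 0%N.
move=> P; split=> [m /Xc[n mn]|n nX n0].
  have [pure _] := (fP (iter n f (exist _ _ bs))).2 P _ (span_submodule X) (cX n.+1).
  exact: pure.
have /choice[N NP] i := Xc _ (nX i).
have [_ fl] := (fP (iter (\max_i N i) f (exist _ _ bs))).2 P _ (span_submodule X) (cX _.+1).
by apply: fl => // i; apply: csm (NP i); apply: leq_bigmax.
Qed.

End Hull.
End Small.
End Noetherian.

(** * The filtration *)

(** The order axioms are read off from least elements of sets with at most three elements,
    antisymmetry from the uniqueness of the least one; well-foundedness comes from a least
    inaccessible element. *)
Lemma strict_well_order_exists (T : eqType) : exists lt : T -> T -> Prop, strict_well_order lt.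
Proof.
have [le wo] := well_ordering_principle T.
have minP (A : T -> Prop) : (exists x, A x) -> exists z, A z /\ forall x, A x -> le z x.
  move=> [x Ax]; have [|z [[zA zmin] _]] := wo [pred x | `[< A x >]].
    by exists x; apply/asboolP.
  exists z; split; first exact/asboolP.
  by move=> y Ay; apply: zmin; apply/asboolP.
have lexx x : le x x.
  by have [|z [-> zm]] := minP (eq x); [exists x|apply: zm].
have anti x y : le x y -> le y x -> x = y.
  move=> xy yx; have [|z [_ zu]] := wo (pred2 x y); first by exists x; rewrite inE eqxx.
  transitivity z; [apply/esym|]; apply: zu; split=> [|w]; rewrite !inE ?eqxx ?orbT //;
    by move=> /orP[]/eqP->.
pose lt x y := le x y /\ x <> y.
have tot x y : lt x y \/ x = y \/ lt y x.
  have [|z [xyz zm]] := minP (fun w => w = x \/ w = y); first by exists x; left.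
  have [xy|nxy] := pselect (x = y); first by right; left.
  case: xyz => zE; subst z; first by left; split=> //; apply: zm; right.
  by right; right; split; [apply: zm; left|move/esym].
exists lt; split; first by move=> x [].
split; [|split].
- move=> x y z [xy nxy] [yz nyz].
  have [//|w [xyzw wm]] := minP (fun w => w = x \/ w = y \/ w = z); first by exists x; left.
  have nzx : x <> z by move=> xz; subst z; apply: nxy; apply: anti.
  split=> //; case: xyzw => [wx|[wy|wz]]; subst w; first by apply: wm; right; right.
    by case: nxy; apply: anti => //; apply: wm; left.
  by case: nyz; apply: anti => //; apply: wm; right; left.
- exact: tot.
- move=> x; apply: contrapT => nx.
  have [|z [nz zm]] := minP (fun x => ~ Acc lt x); first by exists x.
  apply: nz; constructor=> y [yz nyz]; apply: contrapT => ny.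
  by apply: nyz; apply: anti => //; apply: zm.
Qed.

Section Filtration.
Variables (R : comPzRingType) (M : lmodType R) (C : lmodType R -> Prop).
Variable good : (M -> Prop) -> Prop.
Hypothesis good_submodule : forall S, good S -> is_submodule S.
Hypothesis good0 : good (fun x => x = 0).
Hypothesis good_chain : forall (J : Type) (F : J -> M -> Prop), inhabited J ->
  (forall j, good (F j)) ->
  (forall i j, (forall x, F i x -> F j x) \/ (forall x, F j x -> F i x)) ->
  good (fun x => exists j, F j x).
Hypothesis good_step : forall (S : M -> Prop) (b : M), good S -> exists G : M -> Prop,
  [/\ good G, forall x, S x -> G x, G b & exists N, C N /\ quotient_iso N S G].

(** Indices are the elements of [M] under a well-order, with [None] on top. The single formula [McE]
    covers zero, successor and limit indices, and the top term is all of [M] because the step at [b]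
    puts [b] into [E b]. *)
Lemma filtration_exists : transfinite_extension C M.
Proof.
have /choice[next nextP] (Sb : (M -> Prop) * M) : exists G : M -> Prop, good Sb.1 ->
    [/\ good G, forall x, Sb.1 x -> G x, G Sb.2 & exists N, C N /\ quotient_iso N Sb.1 G].
  have [gS|nS] := pselect (good Sb.1); last by exists (fun=> True).
  by have [G GP] := good_step Sb.2 gS; exists G.
have [ltM [irr [tr [tot wf]]]] := strict_well_order_exists M.
pose lt (a b : option M) := match a, b with
  | Some a, Some b => ltM a b | Some _, None => True | None, _ => False end.
have lt_irr a : ~ lt a a by case: a => //= a; apply: irr.
have lt_tr a b c : lt a b -> lt b c -> lt a c.
  by case: a b c => [a|] [b|] [c|] //=; apply: tr.
have lt_tot a b : lt a b \/ a = b \/ lt b a.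
  case: a b => [a|] [b|] /=; by [left|right; left|right; right|have [|[->|]] := tot a b; auto].
have lt_wf : well_founded lt.
  have wfS a : Acc lt (Some a).
    elim/(well_founded_ind wf): a => a IH; constructor=> -[b|]; [exact: IH|case].
  by case=> [a|]; [exact: wfS|constructor=> -[b _|[]]; exact: wfS].
pose step (a : option M) (rec : forall b, lt b a -> M -> Prop) (x : M) :=
  x = 0 \/ exists b (h : lt (Some b) a), next (rec (Some b) h, b) x.
pose Mc := Fix lt_wf (fun=> M -> Prop) step.
pose E b := next (Mc (Some b), b).
have McE a : Mc a = fun x => x = 0 \/ exists b, lt (Some b) a /\ E b x.
  rewrite /Mc Fix_eq => [|c f1 f2 f12].
    apply/funext => x; apply/propext; split=> -[->|[b [h H]]]; try by left.
      by right; exists b.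
    by right; exists b, h.
  suff -> : f1 = f2 by [].
  by apply/functional_extensionality_dep => y; apply/functional_extensionality_dep => h.
have Mc_mono a b : lt a b -> forall x, Mc a x -> Mc b x.
  move=> ab x; rewrite !McE => -[->|[c [ca cx]]]; first by left.
  by right; exists c; split=> //; apply: lt_tr ab.
have E_Mc b a : lt (Some b) a -> forall x, E b x -> Mc a x.
  by move=> ba x Ex; rewrite McE; right; exists b.
have Mc_good a : good (Mc a).
  elim/(well_founded_ind lt_wf): a => a IH.
  have EP b : lt (Some b) a -> good (E b) /\ forall x, Mc (Some b) x -> E b x.
    by move=> ba; have [? ?] := nextP (Mc (Some b), b) (IH _ ba).
  (* The extra index carries the zero submodule, so the family is inhabited even at the bottom. *)
  pose F (j : option {b | lt (Some b) a}) : M -> Prop :=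
    if j is Some b then E (sval b) else fun x => x = 0.
  suff -> : Mc a = fun x => exists j, F j x.
    apply: good_chain; first by constructor; exact: None.
      by case=> [[b ba]|] //=; case: (EP b ba).
    have F0 j x : x = 0 -> F j x.
      case: j => [[b ba]|] //= ->; exact: submodule0 (good_submodule (EP b ba).1).
    have EE b b' : lt (Some b') a -> ltM b b' -> forall x, E b x -> E b' x.
      by move=> b'a bb' x Ex; apply: (EP b' b'a).2; apply: (E_Mc b).
    case=> [[b ba]|]; last by left=> x; apply: F0.
    case=> [[b' ba']|]; last by right=> x; apply: F0.
    by move=> /=; have [|[<-|]] := tot b b'; [left; apply: EE|left|right; apply: EE].
  rewrite McE; apply/funext => x; apply/propext; split=> [[->|[b [ba Ex]]]|].
  - by exists None.
  - by exists (Some (exist _ b ba)).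
  - by case=> -[[b ba] Ex|->]; [right; exists b|left].
have EP b : [/\ good (E b), forall x, Mc (Some b) x -> E b x, E b b &
    exists N, C N /\ quotient_iso N (Mc (Some b)) (E b)].
  exact: (nextP (Mc (Some b), b) (Mc_good _)).
have Mc0 a : Mc a 0 by rewrite McE; left.
have [bot botP] : exists bot, forall a, ~ lt a bot.
  apply: contrapT => nb; suff : forall a : option M, False by move/(_ None).
  apply: (well_founded_ind lt_wf) => a IH; apply: nb; exists a => b; exact: IH.
have swo : strict_well_order lt by exact: (conj lt_irr (conj lt_tr (conj lt_tot lt_wf))).
exists (option M), lt, bot, None, Mc; split; first exact: swo.
split; first exact: botP.
split; first by move=> a [].
split; first by move=> a; apply: good_submodule.
split; first exact: Mc_mono.
split; first by move=> x; split=> [|-> //]; rewrite McE => -[//|[b [/botP]]].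
split; [|split].
- by move=> x; apply: (E_Mc x) => //; case: (EP x).
- move=> a [b0 b0a] lim x; split=> [|[b [ba]]]; last exact: Mc_mono.
  rewrite McE => -[->|[b [ba Ex]]]; first by exists b0.
  by have [c [bc ca]] := lim _ ba; exists c; split=> //; apply: (E_Mc b).
- case=> [a|] s //= as_ cov; have [_ Ma _ [N [CN iso]]] := EP a.
  (* No index lies strictly between [a] and [s], so every [b] below [s] is at most [a], and the
     largest contribution to [Mc s] is [E a]. *)
  exists N; split=> //; suff -> : Mc s = E a by [].
  apply/funext => x; apply/propext; split; last exact: E_Mc.
  rewrite McE => -[->|[b [bs Eb]]]; first exact: Ma.
  have [ab|[->//|ba]] := tot a b; first by case: (cov (Some b)).
  by apply: Ma; apply: (E_Mc b).
Qed.

End Filtration.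

(** * Enlarging a pure submodule with a small flat quotient *)

Section Extension.
Variables (K : Type) (ltK : K -> K -> Prop).
Hypothesis hK : uncountable_regular_cardinal ltK.
Variable R : comPzRingType.
Hypothesis nR : noetherian R.
Hypothesis sSpec : small K (Spec R).
Variable gens : Spec R -> {k : nat & 'I_k -> R}.
Local Notation gen P := (projT2 (gens P)).
Hypothesis genP : forall P, generates (gen P) (sval P).

Lemma syzygy_flat_flat (Q : lmodType R) :
  (forall P, syzygy_flat (gen P) (fun _ : Q => True)) -> flat Q.
Proof.
move=> sf; apply/flat_of_ideals/ideal_flat_all => // P hP.
apply: (@syzygy_ideal_flat R _ (gen (exist _ P hP))); first by case: hP.
  exact: (genP (exist _ P hP)).
exact: sf.
Qed.

(* This is [S ∩ P M = P S], required for prime ideals [P] only. *)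
Definition pure_submodule (M : lmodType R) (S : M -> Prop) : Prop :=
  is_submodule S /\ forall P, relatively_pure (gen P) S S.

Lemma map_ffun_linear k (A B : lmodType R) (f : A -> B) : is_linear f ->
  is_linear (fun v : {ffun 'I_k -> A} => [ffun i => f (v i)]).
Proof. by move=> fL r x y; apply/ffunP => i; rewrite !ffunE fL. Qed.

Lemma map_lincomb k (g : 'I_k -> R) (A B : lmodType R) (f : A -> B)
    (v : {ffun 'I_k -> A}) : is_linear f ->
  lincomb g [ffun i => f (v i)] = f (lincomb g v).
Proof.
move=> fL; rewrite /lincomb (is_linear_sum fL); apply: eq_bigr => i _.
by rewrite ffunE (is_linearZ fL).
Qed.

Lemma map_vscale k (c : {ffun 'I_k -> R^o}) (A B : lmodType R) (f : A -> B) y : is_linear f ->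
  [ffun i => f (vscale c y i)] = vscale c (f y).
Proof. by move=> fL; apply/ffunP => i; rewrite !ffunE (is_linearZ fL). Qed.

(** Lift a relation in [Q] to a tuple [x] in [M]. Its combination lies in [S], so by purity it
    equals that of a tuple [y] in [S]; then [x - y] is a relation in [M] with the same image, and
    trivial relations map to trivial ones. *)
Lemma quotient_syzygy_flat k (g : 'I_k -> R) (M Q : lmodType R) (S : M -> Prop) (pi : M -> Q) :
  is_linear pi -> (forall q, exists x, pi x = q) -> (forall x, pi x = 0 <-> S x) ->
  relatively_pure g S S -> syzygy_flat g (fun _ : M => True) ->
  syzygy_flat g (fun _ : Q => True).
Proof.
move=> piL /choice[rep repK] piE pure sf n _ n0.
pose x := [ffun i => rep (n i)].
have xn : [ffun i => pi (x i)] = n by apply/ffunP => i; rewrite !ffunE repK.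
have [|y [yS yx]] := pure x; first by apply/piE; rewrite -map_lincomb // xn.
have <- : [ffun i => pi ((x - y) i)] = n.
  by apply/ffunP => i; rewrite -xn !ffunE (is_linearB piL) (piE (y i)).2 ?subr0.
apply: (span_linear (map_ffun_linear (k := k) piL)); last first.
  by apply: sf => //; rewrite (is_linearB (@lincomb_linear _ _ g M)) yx subrr.
move=> _ [c [z [c0 [_ ->]]]]; apply: mem_span; exists c, (pi z).
by rewrite map_vscale.
Qed.

Lemma sub_syzygy_flat k (g : 'I_k -> R) (P Q : lmodType R) (N : Q -> Prop) (i : P -> Q) :
  is_linear i -> injective i -> (forall x, N x <-> exists p, i p = x) ->
  syzygy_flat g N -> syzygy_flat g (fun _ : P => True).
Proof.
move=> iL iI iE sf n _ n0; pose mi (v : {ffun 'I_k -> P}) := [ffun j => i (v j)].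
have miL : is_linear mi by exact: map_ffun_linear.
have [v vT vn] : exists2 v, in_span (trivial_relation g (fun _ : P => True)) v & mi v = mi n.
  apply: (sf (mi n) _ _
    (fun w => exists2 v, in_span (trivial_relation g (fun _ : P => True)) v & mi v = w)).
  - by move=> j; rewrite ffunE; apply/iE; exists (n j).
  - by rewrite map_lincomb // n0 is_linear0.
  - exact: submodule_image.
  - move=> _ [c [y [c0 [/iE[p <-] ->]]]]; exists (vscale c p); last exact: map_vscale.
    by apply: mem_span; exists c, p.
suff <- : v = n by [].
by apply/ffunP => j; apply: iI; move/ffunP/(_ j): vn; rewrite !ffunE.
Qed.

(** [M / S] inherits [syzygy_flat] from [M], so it contains a hull of the class of [b]. [G] is the
    preimage of this hull, and [G / S] is the hull itself. *)
Lemma pure_extension (M : lmodType R) (S : M -> Prop) (b : M) :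
  (forall P, syzygy_flat (gen P) (fun _ : M => True)) -> pure_submodule S ->
  exists G : M -> Prop, [/\ pure_submodule G, forall x, S x -> G x, G b &
    exists N : lmodType R, (lt_generated K N /\ flat N) /\ quotient_iso N S G].
Proof.
move=> fM [hS pS]; have [Q [pi [piL [pis piE]]]] := quotient_lmodule hS.
have fQ P : syzygy_flat (gen P) (fun _ : Q => True).
  by apply: quotient_syzygy_flat piL pis piE _ _.
have [X [Xs [Xb XP]]] := pure_flat_hull nR hK sSpec fQ (pi b).
have [N [i [iL [iI iE]]]] := sub_lmodule (span_submodule X).
have [rep repK] := choice pis.
have SG x : S x -> in_span X (pi x) by move=> /piE->; apply: span0.
exists (fun x => in_span X (pi x)); split=> //; last 2 first.
- exact: mem_span.
- exists N; split; first split.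
  + exists (fun p => X (i p)); split.
      apply: (small_card_lt hK); apply: small_le Xs.
      pose f (p : {p | X (i p)}) : {x | X x} := exist _ (i (sval p)) (proj2_sig p).
      by exists f => -[p Xp] [q Xq] /(congr1 sval) /= /iI pq; apply: eq_exist.
    (* The generators are pulled back along the injection [i], so it suffices that the image of
       their span contains [i n]. *)
    move=> n; have [p pX /iI <- //] : exists2 p, in_span (fun p => X (i p)) p & i p = i n.
    have /iE : exists p, i p = i n by exists n.
    move: (i n); apply: span_ind; first exact: submodule_image.
    move=> y Xy; have /iE[p py] := mem_span Xy; exists p => //.
    by apply: mem_span; rewrite py.
  + apply: syzygy_flat_flat => P; apply: sub_syzygy_flat iL iI iE _.
    exact: (XP P).2.
  + have /choice[g gP] x : exists p, in_span X (pi x) -> i p = pi x.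
      have [/iE[p pP]|nx] := pselect (in_span X (pi x)); [by exists p|by exists 0].
    exists g; split; last split.
    * move=> r x y Gx Gy; apply: iI; rewrite gP; first by rewrite piL iL !gP.
      by rewrite piL; apply: spanD => //; apply: spanZ.
    * move=> n; have [x xn] := pis (i n).
      have Gx : in_span X (pi x) by apply/iE; exists n.
      by exists x; split=> //; apply: iI; rewrite gP.
    * move=> x Gx; rewrite -piE -gP //; split=> [->|gx]; first exact: is_linear0.
      by apply: iI; rewrite gx is_linear0.
split; first exact: submodule_preim.
move=> P m; rewrite -map_lincomb // => /((XP P).1)[n [nX nm]].
pose y := [ffun j => rep (n j)].
have piy : [ffun j => pi (y j)] = n by apply/ffunP => j; rewrite !ffunE repK.
have lL := @lincomb_linear _ _ (gen P) M.
(* The hull solves the equation only modulo [S]; the error is the combination of [m - y], which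
   purity of [S] rewrites with entries in [S]. *)
have [|z [zS zE]] := pS P (m - y).
  apply/piE; rewrite (is_linearB lL) (is_linearB piL) -!(map_lincomb _ _ piL) piy.
  by rewrite nm subrr.
exists (y + z); split; last by rewrite (is_linearD lL) zE (is_linearB lL) addrC subrK.
move=> j; rewrite ffunE (is_linearD piL); apply: spanD; last exact: SG.
by move/ffunP/(_ j): piy; rewrite ffunE => ->.
Qed.

End Extension.

Theorem theorem3p8 (K : Type) (ltK : K -> K -> Prop)
    (hK : uncountable_regular_cardinal ltK)
    (R : comPzRingType) (hR : noetherian R) (hSpec : card_lt (Spec R) K)
    (M : lmodType R) (hM : flat M) :
  transfinite_extension (fun N : lmodType R => lt_generated K N /\ flat N) M.
Proof.
have /choice[gens genP] (P : Spec R) := ideal_generators hR (proj2_sig P).1.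
have fM P : syzygy_flat (projT2 (gens P)) (fun _ : M => True) by apply: flat_syzygy.
apply: (@filtration_exists _ _ _ (@pure_submodule R gens M)).
- by move=> S [].
- split; first by split=> //; split=> [x y -> ->|r x ->]; rewrite ?addr0 ?scaler0.
  move=> P m m0; exists 0; split=> [j|]; first by rewrite ffunE.
  by rewrite m0; apply: is_linear0; apply: lincomb_linear.
- move=> J F [j0] Fp Fc; split; last first.
    (* Purity constrains only the single element [lincomb m], which lies in one member of the
       chain. *)
    move=> P m [j Fm]; have [n [nF nm]] := (Fp j).2 P m Fm.
    by exists n; split=> // i; exists j.
  split; first by exists j0; apply: (submodule0 (Fp j0).1).
  split=> [x y [i Fx] [j Fy]|r x [j Fx]]; last by exists j; apply: (submoduleZ (Fp j).1).
  have [ij|ji] := Fc i j; [exists j|exists i]; apply: (submoduleD (Fp _).1) => //;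
    by [apply: ij|apply: ji].
- move=> S b gS; exact: (pure_extension hK hR hSpec.2 genP b fM gS).
Qed.
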